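(* Let $\Omega \subset \mathbb{R}^2$ be a bounded open Lipschitz domain, and let $\kappa_1, \kappa_2 : \Omega \to \mathbb{R}$ be bounded and Lebesgue integrable functions, each of which is constant on a (nonempty) open subdomain $S \subset \Omega$. Let $K$ be the diagonal tensor $$K(x,y)=\begin{bmatrix} \kappa_1(x,y) & 0 \\ 0 & \kappa_2(x,y)\end{bmatrix}, \qquad (x,y)\in\Omega,$$ and let $\mathcal{L}, \mathcal{A}: H_0^1(\Omega)\to H^{-1}(\Omega)$ be the operators defined by $\langle \mathcal{L}\phi,\psi\rangle = \int_\Omega \nabla\phi\cdot\nabla\psi$ and $\langle \mathcal{A}\phi,\psi\rangle = \int_\Omega K\nabla\phi\cdot\nabla\psi$ for $\phi,\psi\in H_0^1(\Omega)$. If $$\sup_{(x,y)\in\Omega}\kappa_1(x,y) < \inf_{(x,y)\in\Omega}\kappa_2(x,y),$$ then $$\Big[\sup_{(x,y)\in\Omega}\kappa_1(x,y),\ \inf_{(x,y)\in\Omega}\kappa_2(x,y)\Big]\subset \mathrm{sp}(\mathcal{L}^{-1}\mathcal{A}).$$ The analogous statement holds with the roles of $\kappa_1$ and $\kappa_2$ interchanged: if $\sup_{(x,y)\in\Omega}\kappa_2(x,y) < \inf_{(x,y)\in\Omega}\kappa_1(x,y)$, then $\big[\sup_{(x,y)\in\Omega}\kappa_2(x,y),\ \inf_{(x,y)\in\Omega}\kappa_1(x,y)\big]\subset \mathrm{sp}(\mathcal{L}^{-1}\mathcal{A})$.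
   Context: $H_0^1(\Omega)$ is the usual Sobolev space with zero boundary trace, with the norm given by the $H^1$ semi-norm $|u|_{H^1(\Omega)} = (\int_\Omega |\nabla u|^2)^{1/2}$, and $H^{-1}(\Omega)$ is its dual, with duality pairing $\langle\cdot,\cdot\rangle$. The operator $\mathcal{L}$ (the weak Dirichlet Laplacian, up to sign) is boundedly invertible, so $\mathcal{L}^{-1}\mathcal{A}: H_0^1(\Omega)\to H_0^1(\Omega)$ is a well-defined bounded operator. Its spectrum is $$\mathrm{sp}(\mathcal{L}^{-1}\mathcal{A}) = \{\lambda\in\mathbb{C} : \lambda\mathcal{I}-\mathcal{L}^{-1}\mathcal{A} \text{ does not have a bounded inverse}\},$$ where $\mathcal{I}$ is the identity on $H_0^1(\Omega)$. Suprema and infima are taken pointwise over $\Omega$. *)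

(* Defs.v *)
From HB Require Import structures.
From mathcomp Require Import all_boot all_order all_algebra complex.
From mathcomp Require Import all_classical all_reals all_analysis.
From mathcomp Require Import measurable_realfun ring lra.

Set Implicit Arguments.
Unset Strict Implicit.
Unset Printing Implicit Defensive.

Import Order.TTheory GRing.Theory Num.Theory numFieldNormedType.Exports.

Local Open Scope classical_set_scope.
Local Open Scope ring_scope.
Local Open Scope quotient_scope.

Section ae_lmodule.
Context d (T : measurableType d) (R : realType)
        (mu : {measure set T -> \bar R}).
Local Notation M := {mfun_ mu, T >-> R}.
Implicit Types (f g : {mfun T >-> R}) (u v w : M).

Lemma pi_ae f g : f = g %[ae mu] <-> \pi_M f = \pi_M g.
Proof. by split=> [h|/eqmodP/asboolP//]; apply/eqmodP/asboolP. Qed.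

Lemma repr_pi_ae f : repr (\pi_M f) = f %[ae mu].
Proof. by apply/pi_ae; rewrite reprK. Qed.

Definition ae_zero : M := \pi_M 0.
Definition ae_opp u : M := \pi_M (- repr u).
Definition ae_add u v : M := \pi_M (repr u + repr v).
Definition ae_scale (a : R) u : M := \pi_M (a *: repr u).

Lemma pi_opp f : \pi_M (- f) = ae_opp (\pi_M f).
Proof.
apply/pi_ae; apply: filterS (repr_pi_ae f) => x h _.
by rewrite -[LHS]/(- f x) -[RHS]/(- repr (\pi_M f) x) h.
Qed.

Lemma pi_add f g : \pi_M (f + g) = ae_add (\pi_M f) (\pi_M g).
Proof.
apply/pi_ae; apply: filterS2 (repr_pi_ae f) (repr_pi_ae g) => x hf hg _.
rewrite -[LHS]/(f x + g x).
by rewrite -[RHS]/(repr (\pi_M f) x + repr (\pi_M g) x) hf// hg.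
Qed.

Lemma pi_scale a f : \pi_M (a *: f) = ae_scale a (\pi_M f).
Proof.
apply/pi_ae; apply: filterS (repr_pi_ae f) => x h _.
by rewrite -[LHS]/(a * f x) -[RHS]/(a * repr (\pi_M f) x) h.
Qed.

Let addA : associative ae_add.
Proof.
elim/quotW=> f; elim/quotW=> g; elim/quotW=> h.
by rewrite -(pi_add g) -(pi_add f) -(pi_add f g) -(pi_add _ h) addrA.
Qed.

Let addC : commutative ae_add.
Proof. by elim/quotW=> f; elim/quotW=> g; rewrite -!pi_add addrC. Qed.

Let add0 : left_id ae_zero ae_add.
Proof. by elim/quotW=> f; rewrite -pi_add add0r. Qed.

Let addN : left_inverse ae_zero ae_opp ae_add.
Proof. by elim/quotW=> f; rewrite -(pi_opp f) -pi_add addNr. Qed.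

HB.instance Definition _ := GRing.isZmodule.Build M addA addC add0 addN.

Let scaleA a b u : ae_scale a (ae_scale b u) = ae_scale (a * b) u.
Proof. by elim/quotW: u => f; rewrite -(pi_scale b) -(pi_scale a) -pi_scale scalerA. Qed.

Let scale1 : left_id 1 ae_scale.
Proof. by elim/quotW=> f; rewrite -pi_scale scale1r. Qed.

Let scaleDr : right_distributive ae_scale +%R.
Proof.
move=> a; elim/quotW=> f; elim/quotW=> g.
rewrite -[LHS]/(ae_scale a (ae_add _ _)) -[RHS]/(ae_add _ _).
by rewrite -(pi_add f g) -(pi_scale a f) -(pi_scale a g) -pi_add -scalerDr pi_scale.
Qed.

Let scaleDl u : {morph ae_scale^~ u : a b / a + b}.
Proof. elim/quotW: u => f a b /=; rewrite -[RHS]/(ae_add _ _).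
by rewrite -(pi_scale a f) -(pi_scale b f) -pi_add -scalerDl pi_scale. Qed.

HB.instance Definition _ :=
  GRing.Zmodule_isLmodule.Build R M scaleA scale1 scaleDr scaleDl.

Lemma ae0 : (0 : M) = cst 0 %[ae mu].
Proof. exact: repr_pi_ae. Qed.

Lemma aeD u v : (u + v : M) = (u : T -> R) \+ v %[ae mu].
Proof. exact: repr_pi_ae. Qed.

Lemma aeZ a u : (a *: u : M) = a \*: (u : T -> R) %[ae mu].
Proof. exact: repr_pi_ae. Qed.

End ae_lmodule.

Notation plane R := (measurableTypeR R * measurableTypeR R)%type.


Section domain.
Context {R : realType}.
Implicit Types (Om : set (R * R)) (phi : R * R -> R).

Lemma open_measurable2 Om : open Om -> measurable (Om : set (plane R)).
Proof.
move=> oO.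
pose F (i : rat * rat * nat) : set (plane R) :=
  (ball (ratr i.1.1 : R) i.2.+1%:R^-1 `*` ball (ratr i.1.2 : R) i.2.+1%:R^-1).
rewrite (_ : Om = \bigcup_i (if `[< F i `<=` Om >] then F i else set0)); last first.
  apply/seteqP; split => [[x y] Oxy|p [i _]]; last first.
    by case: asboolP => // h /h.
  have /nbhs_ballP[e /= e0 eO] : nbhs (x, y) Om by apply: open_nbhs_nbhs.
  have [n nP] : exists n : nat, n.+1%:R^-1 < e / 2.
    near \oo => n; exists n; near: n; apply: near_infty_natSinv_lt (PosNum _).
    by rewrite divr_gt0.
  have rP (z : R) : exists q : rat, ball (ratr q : R) n.+1%:R^-1 z.
    have [|q] := @rat_in_itvoo R (z - n.+1%:R^-1) (z + n.+1%:R^-1).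
      by rewrite ltrBlDr -addrA ltrDl addr_gt0.
    rewrite in_itv /= => /andP[h1 h2]; exists q.
    by rewrite /ball /= ltr_distl h1 h2.
  have [q1 q1P] := rP x; have [q2 q2P] := rP y.
  exists (q1, q2, n) => //; case: asboolP => [_|]; first by split.
  case=> -[a b] [/= ha hb]; apply: eO; split => /=.
    apply: le_ball (ltW _) _ (ball_triangle (ball_sym q1P) ha).
    by rewrite [ltRHS]splitr ltrD.
  apply: le_ball (ltW _) _ (ball_triangle (ball_sym q2P) hb).
  by rewrite [ltRHS]splitr ltrD.
apply: countable_bigcupT_measurable => // i; case: ifPn => // _.
by apply: measurableX; apply: measurable_ball.
Unshelve. all: by end_near. Qed.

Lemma continuous_measurable2 phi :
  continuous phi -> measurable_fun setT (phi : plane R -> R).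
Proof.
move=> /continuousP cf mD; apply: (measurability _ (RGenOpens.measurableE R)) => //.
move=> _ [_ [a [b ->] <-]]; rewrite setTI; apply: open_measurable2.
by apply: cf; exact: interval_open.
Qed.

Definition lebesgue2 : set (plane R) -> \bar R :=
  (@lebesgue_measure R \x @lebesgue_measure R)%E.
HB.instance Definition _ := Measure.on lebesgue2.

Lemma compact_lebesgue2 (K : set (R * R)) :
  compact K -> measurable (K : set (plane R)) /\ (lebesgue2 K < +oo)%E.
Proof.
move=> cK.
have mK : measurable (K : set (plane R)).
  have /closed_openC/open_measurable2/measurableC : closed K.
    by apply: compact_closed => //; exact: norm_hausdorff.
  by rewrite setCK.
split=> //; have /ex_strict_bound_gt0 [M M0 KM] := compact_bounded cK.
pose B : set (plane R) := `[- M, M] `*` `[- M, M].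
apply: (@le_lt_trans _ _ (lebesgue2 B)).
  apply: le_measure; rewrite ?inE//; first exact: measurableX.
  move=> [x y] /KM /= h.
  have [hx hy] : `|x| < M /\ `|y| < M.
    by move: h; rewrite prod_normE /= gt_max => /andP[].
  by split; rewrite /= in_itv/= -ler_norml ltW.
rewrite /lebesgue2 product_measure1E//= !lebesgue_measure_itv/=.
by rewrite lte_fin; case: ifP => _; rewrite -?EFinB -?EFinM ?ltry ?mule0.
Qed.

Definition lebesgue_on Om (oOm : open Om) : set (plane R) -> \bar R :=
  mrestr lebesgue2 (open_measurable2 oOm).
HB.instance Definition _ Om (oOm : open Om) := Measure.on (lebesgue_on oOm).

Lemma lebesgue_on_le Om (oOm : open Om) (K : set (plane R)) :
  measurable K -> (lebesgue_on oOm K <= lebesgue2 K)%E.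
Proof.
move=> mK; pose mI := measurableI _ _ mK (open_measurable2 oOm).
exact: (le_measure lebesgue2 (mem_set mI) (mem_set mK) (@subIsetl _ _ _)).
Qed.

Definition partial1 phi : R * R -> R := fun p => 'D_(1, 0) phi p.
Definition partial2 phi : R * R -> R := fun p => 'D_(0, 1) phi p.

Fixpoint Ck (k : nat) phi : Prop :=
  if k is k'.+1 then
    [/\ continuous phi, forall p, derivable phi p (1, 0),
      forall p, derivable phi p (0, 1), Ck k' (partial1 phi) &
      Ck k' (partial2 phi)]
  else continuous phi.

Definition test_function Om phi :=
  [/\ forall k, Ck k phi, compact (closure [set p | phi p != 0]) &
      closure [set p | phi p != 0] `<=` Om].

Lemma derive_lin a phi psi (v : R * R) : (forall p, derivable phi p v) ->
  (forall p, derivable psi p v) ->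
  (forall p, derivable (fun p => a * phi p + psi p) p v) /\
  (fun p => 'D_v (fun p => a * phi p + psi p) p) =
  (fun p => a * 'D_v phi p + 'D_v psi p).
Proof.
move=> df dg; split=> [p|].
  by apply: derivableD => //; exact: derivableZ.
apply/funext => p.
by rewrite deriveD//; [rewrite deriveZ//|exact: derivableZ].
Qed.

Lemma Ck_lin k a phi psi :
  Ck k phi -> Ck k psi -> Ck k (fun p => a * phi p + psi p).
Proof.
elim: k phi psi => [|k IH] phi psi /=.
  move=> cf cg p; apply: cvgD; last exact: cg.
  by apply: cvgMr; exact: cf.
move=> [cf f1 f2 cf1 cf2] [cg g1 g2 cg1 cg2].
have [D1 E1] := derive_lin a f1 g1; have [D2 E2] := derive_lin a f2 g2.
split; [|exact: D1|exact: D2| |].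
- by move=> p; apply: cvgD; [apply: cvgMr; exact: cf|exact: cg].
- have -> : partial1 (fun p => a * phi p + psi p) =
    (fun p => a * partial1 phi p + partial1 psi p) := E1.
  exact: IH cf1 cg1.
- have -> : partial2 (fun p => a * phi p + psi p) =
    (fun p => a * partial2 phi p + partial2 psi p) := E2.
  exact: IH cf2 cg2.
Qed.

Lemma test_function_partial_lin Om a phi psi : test_function Om phi ->
  test_function Om psi ->
  partial1 (fun p => a * phi p + psi p) =
    (fun p => a * partial1 phi p + partial1 psi p) /\
  partial2 (fun p => a * phi p + psi p) =
    (fun p => a * partial2 phi p + partial2 psi p).
Proof.
move=> [/(_ 1%N)[_ f1 f2 _ _] _ _] [/(_ 1%N)[_ g1 g2 _ _] _ _].
by split; [exact: (derive_lin a f1 g1).2|exact: (derive_lin a f2 g2).2].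
Qed.

Lemma test_function_lin Om a phi psi : test_function Om phi ->
  test_function Om psi -> test_function Om (fun p => a * phi p + psi p).
Proof.
move=> [sf cf fO] [sg cg gO].
have sub : closure [set p | a * phi p + psi p != 0] `<=`
    closure [set p | phi p != 0] `|` closure [set p | psi p != 0].
  rewrite -closureU; apply: closureS => p /= h.
  have [f0|] := eqVneq (phi p) 0; last by left.
  by right; move: h; rewrite f0 mulr0 add0r.
split.
- by move=> k; exact: Ck_lin.
- apply: subclosed_compact (compactU cf cg) sub; exact: closed_closure.
- by move=> p /sub[/fO|/gO].
Qed.

Lemma test_function0 Om : test_function Om (fun=> 0).
Proof.
have E : closure [set p : R * R | (0 : R) != 0] = set0.
  by rewrite (_ : mkset _ = set0) ?closure0//; apply/seteqP; split => // p /=; rewrite eqxx.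
split; rewrite ?E//; last exact: compact0.
elim=> [|k IH] /=; first exact: cst_continuous.
split; [exact: cst_continuous|move=> p; exact: derivable_cst|
  move=> p; exact: derivable_cst| |].
- by rewrite (_ : partial1 _ = fun=> 0)//; apply/funext => p; exact: derive_cst.
- by rewrite (_ : partial2 _ = fun=> 0)//; apply/funext => p; exact: derive_cst.
Qed.

Lemma Lfun2_compact Om (oOm : open Om) phi (K : set (R * R)) :
  continuous phi -> compact K -> (forall p, ~ K p -> phi p = 0) ->
  (phi : plane R -> R) \in Lfun (lebesgue_on oOm) 2%:E.
Proof.
move=> cf cK f0; have mf := continuous_measurable2 cf.
have [mK Kfin] := compact_lebesgue2 cK.
have [M M0 fM] : exists2 M, 0 < M & forall p, `|phi p| <= M.
  have : compact (phi @` K).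
    by apply: continuous_compact => //; exact: continuous_subspaceT.
  move=> /compact_bounded/ex_strict_bound_gt0 [M M0 KM].
  exists M => // p; have [Kp|/f0 ->] := pselect (K p).
    by apply/ltW/KM; exists p.
  by rewrite normr0 ltW.
apply/andP; split; rewrite inE//= /finite_norm unlock.
apply: poweR_lty.
apply: (@le_lt_trans _ _
  (\int[lebesgue_on oOm]_p ((M ^+ 2)%:E * (\1_K p)%:E))%E).
  apply: ge0_le_integral => //.
  - by move=> p _; rewrite lee_fin powR_ge0.
  - apply/measurable_EFinP.
    apply: (@measurableT_comp _ _ _ _ _ _ (@powR R ^~ 2)) => //.
    exact: measurableT_comp.
  - by apply/measurable_EFinP; apply: measurable_funM.
  - move=> p _; rewrite -EFinM lee_fin powR_mulrn// indicE.
    case: (boolP (p \in K)) => [_|/negP pK]; first by rewrite mulr1 lerXn2r ?nnegrE// ltW.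
    by rewrite mulr0 f0 ?normr0 ?expr0n//= => /mem_set.
rewrite ge0_integralZl//; first last.
- by rewrite lee_fin exprn_ge0// ltW.
- exact/measurable_EFinP.
rewrite integral_indic// setIT lte_mul_pinfty ?lee_fin ?exprn_ge0 ?(ltW M0)//.
exact: le_lt_trans (lebesgue_on_le oOm mK) Kfin.
Qed.

Lemma derive_support phi (v p : R * R) :
  ~ closure [set q | phi q != 0] p -> 'D_v phi p = 0.
Proof.
move=> np.
have : nbhs p (~` closure [set q | phi q != 0]).
  by apply: open_nbhs_nbhs; split=> //; apply: closed_openC; exact: closed_closure.
move=> h; rewrite (@near_eq_derive _ _ _ phi (cst 0) p) ?derive_cst//.
near=> q; have : ~ closure [set q | phi q != 0] q by near: q.
by have [//|q0 []] := eqVneq (phi q) 0; exact: subset_closure.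
Unshelve. all: by end_near. Qed.

Lemma test_function_Lfun2 Om (oOm : open Om) phi : test_function Om phi ->
  [/\ (phi : plane R -> R) \in Lfun (lebesgue_on oOm) 2%:E,
      (partial1 phi : plane R -> R) \in Lfun (lebesgue_on oOm) 2%:E &
      (partial2 phi : plane R -> R) \in Lfun (lebesgue_on oOm) 2%:E].
Proof.
move=> [sf cK _]; have [_ _ _ c1 c2] := sf 1%N.
split; apply: (Lfun2_compact _ _ cK) => //.
- exact: (sf 0%N).
- move=> p np; apply/eqP/negPn/negP => h; apply: np; exact: subset_closure.
- by move=> p; exact: derive_support.
- by move=> p; exact: derive_support.
Qed.

End domain.

Section ae_Lfun.
Context d (T : measurableType d) (R : realType)
        (mu : {measure set T -> \bar R}).

Implicit Types f g h : T -> R.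

Lemma eq_ae_Lnorm2 f g : measurable_fun setT f -> measurable_fun setT g ->
  f = g %[ae mu] -> ('N[mu]_2%:E[EFin \o f] = 'N[mu]_2%:E[EFin \o g])%E.
Proof.
move=> mf mg fg; rewrite Lnorm.unlock; apply: (congr1 (fun z => poweR z _)).
apply: ae_eq_integral; first exact: measurableT.
- apply/measurable_EFinP.
  apply: (@measurableT_comp _ _ _ _ _ _ (@powR R ^~ 2)) => //.
  exact: measurableT_comp.
- apply/measurable_EFinP.
  apply: (@measurableT_comp _ _ _ _ _ _ (@powR R ^~ 2)) => //.
  exact: measurableT_comp.
- by apply: filterS fg => x /= h _; rewrite h.
Qed.

Lemma Lfun_measurable f : f \in Lfun mu 2%:E -> measurable_fun setT f.
Proof. by move=> /andP[]; rewrite inE. Qed.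

Lemma eq_ae_Lfun2 f g : measurable_fun setT g -> f = g %[ae mu] ->
  f \in Lfun mu 2%:E -> g \in Lfun mu 2%:E.
Proof.
move=> mg fg Lf; have := eq_ae_Lnorm2 (Lfun_measurable Lf) mg fg.
move: Lf => /andP[_]; rewrite inE/= /finite_norm => + E; rewrite E => h.
by apply/andP; split; rewrite inE.
Qed.

Lemma eq_ae_RintegralM f g h : measurable_fun setT f ->
  measurable_fun setT g -> measurable_fun setT h -> f = g %[ae mu] ->
  \int[mu]_x (f x * h x) = \int[mu]_x (g x * h x).
Proof.
move=> mf mg mh fg; rewrite /Rintegral; congr fine.
apply: ae_eq_integral; first exact: measurableT.
- by apply/measurable_EFinP; exact: measurable_funM.
- by apply/measurable_EFinP; exact: measurable_funM.
- by apply: filterS fg => x /= e _; rewrite e.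
Qed.

End ae_Lfun.

Section sobolev.
Context {R : realType} (Om : set (R * R)) (oOm : open Om).
Local Notation mu := (lebesgue_on oOm).
Local Notation M := {mfun_ mu, plane R >-> R}.
Implicit Types (u v g : M) (w : M * M * M) (phi : R * R -> R).

Definition weak_partial (D : (R * R -> R) -> R * R -> R) u g :=
  forall phi, test_function Om phi ->
    \int[mu]_p (u p * D phi p) = - \int[mu]_p (g p * phi p).

Definition H1 : set (M * M * M) := [set w : M * M * M |
  [/\ (w.1.1 : plane R -> R) \in Lfun mu 2%:E,
      (w.1.2 : plane R -> R) \in Lfun mu 2%:E,
      (w.2 : plane R -> R) \in Lfun mu 2%:E,
      weak_partial partial1 w.1.1 w.1.2 &
      weak_partial partial2 w.1.1 w.2]].

Definition H10 : set (M * M * M) := [set w : M * M * M | H1 w /\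
  forall e : R, 0 < e -> exists2 phi, test_function Om phi &
    [/\ 'N[mu]_2%:E [EFin \o ((w.1.1 : plane R -> R) \- phi)%R] < e%:E,
        'N[mu]_2%:E [EFin \o ((w.1.2 : plane R -> R) \- partial1 phi)%R] < e%:E &
        'N[mu]_2%:E [EFin \o ((w.2 : plane R -> R) \- partial2 phi)%R] < e%:E]%E].

Definition H10_pred : {pred M * M * M} := fun w => `[< H10 w >].

Let lin_ae a u v : ((a *: u + v : M) : plane R -> R) =
  (a \*: (u : plane R -> R) \+ v) %[ae mu].
Proof.
apply: filterS2 (aeD (a *: u) v) (aeZ a u) => p h1 h2 _.
by rewrite h1//= h2.
Qed.

Let mfunE u : measurable_fun setT (u : plane R -> R).
Proof. exact: measurable_funPT. Qed.

Let le12 : (1 <= (2 : R)%:E :> \bar R)%E.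
Proof. by rewrite lee_fin ler1n. Qed.

Let Lfun_linf a (f g : plane R -> R) : f \in Lfun mu 2%:E -> g \in Lfun mu 2%:E ->
  a \*: f \+ g \in Lfun mu 2%:E.
Proof. exact: (Lfun_submod_closed mu le12).2. Qed.

Let LfunB (f g : plane R -> R) : f \in Lfun mu 2%:E -> g \in Lfun mu 2%:E ->
  f \- g \in Lfun mu 2%:E.
Proof.
move=> hf hg; rewrite (_ : f \- g = -1 \*: g \+ f); first exact: Lfun_linf.
by apply/funext => p /=; rewrite scaleN1r addrC.
Qed.

Let Lfun_lin a u v : (u : plane R -> R) \in Lfun mu 2%:E ->
  (v : plane R -> R) \in Lfun mu 2%:E ->
  ((a *: u + v : M) : plane R -> R) \in Lfun mu 2%:E.
Proof.
move=> hu hv; apply: (eq_ae_Lfun2 (mfunE _) (ae_eq_sym (lin_ae a u v))).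
exact: Lfun_linf.
Qed.

Lemma int_lin a u v (h : plane R -> R) :
  (u : plane R -> R) \in Lfun mu 2%:E -> (v : plane R -> R) \in Lfun mu 2%:E ->
  h \in Lfun mu 2%:E ->
  \int[mu]_p ((a *: u + v : M) p * h p) =
  a * \int[mu]_p (u p * h p) + \int[mu]_p (v p * h p).
Proof.
move=> hu hv hh.
have iu : mu.-integrable setT (EFin \o (fun p => u p * h p)).
  by apply/Lfun1_integrable; exact: Lfun2_mul_Lfun1.
have iv : mu.-integrable setT (EFin \o (fun p => v p * h p)).
  by apply/Lfun1_integrable; exact: Lfun2_mul_Lfun1.
rewrite (eq_ae_RintegralM (mfunE _) _ (Lfun_measurable hh) (lin_ae a u v)); last first.
  exact: Lfun_measurable (Lfun_linf a hu hv).
rewrite -RintegralZl// -RintegralD//; last first.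
  rewrite (_ : _ \o _ = fun p => (a%:E * (u p * h p)%:E)%E)//.
  exact: integrableZl.
by apply: eq_Rintegral => p _ /=; rewrite mulrA -mulrDl.
Qed.

Let weak_partial_lin D a u g v g' :
  (forall phi, test_function Om phi ->
     (D phi : plane R -> R) \in Lfun mu 2%:E) ->
  (u : plane R -> R) \in Lfun mu 2%:E -> (g : plane R -> R) \in Lfun mu 2%:E ->
  (v : plane R -> R) \in Lfun mu 2%:E -> (g' : plane R -> R) \in Lfun mu 2%:E ->
  weak_partial D u g -> weak_partial D v g' ->
  weak_partial D (a *: u + v) (a *: g + g').
Proof.
move=> LD Lu Lg Lv Lg' ug vg phi tphi.
have [Lphi _ _] := test_function_Lfun2 oOm tphi.
rewrite (int_lin a Lu Lv (LD _ tphi)) (int_lin a Lg Lg' Lphi).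
by rewrite ug// vg// opprD mulrN.
Qed.

Let approx_lin (e a : R) u v (f g : R * R -> R) : 0 < e ->
  (u : plane R -> R) \in Lfun mu 2%:E -> (v : plane R -> R) \in Lfun mu 2%:E ->
  (f : plane R -> R) \in Lfun mu 2%:E -> (g : plane R -> R) \in Lfun mu 2%:E ->
  ('N[mu]_2%:E [EFin \o ((u : plane R -> R) \- f)%R] < (e / 2 / (`|a| + 1))%:E)%E ->
  ('N[mu]_2%:E [EFin \o ((v : plane R -> R) \- g)%R] < (e / 2)%:E)%E ->
  ('N[mu]_2%:E [EFin \o (((a *: u + v)%R : M) \- (fun p => a * f p + g p))%R] < e%:E)%E.
Proof.
move=> e0 Lu Lv Lf Lg hf hg.
pose F : plane R -> R := (u : plane R -> R) \- f.
pose G : plane R -> R := (v : plane R -> R) \- g.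
have LF : F \in Lfun mu 2%:E by exact: LfunB.
have LG : G \in Lfun mu 2%:E by exact: LfunB.
have mF := Lfun_measurable LF; have mG := Lfun_measurable LG.
have maF : measurable_fun setT (a \*: F) by exact: measurable_funM.
rewrite (@eq_ae_Lnorm2 _ _ _ mu _ (a \*: F \+ G)).
- apply: (le_lt_trans (eminkowski mu maF mG le12)).
  rewrite (LnormZ (Lfun_Sub le12 LF) a)
    [ltRHS](_ : _ = ((e / 2)%:E + (e / 2)%:E)%E); last by rewrite -EFinD -splitr.
  apply: lteD => //.
  apply: le_lt_trans (_ : ((`|a| + 1)%:E * 'N[mu]_2%:E[EFin \o F] < _)%E).
    by apply: lee_wpmul2r; [exact: Lnorm_ge0|rewrite lee_fin lerDl].
  have a1 : 0 < `|a| + 1 by rewrite ltr_wpDl.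
  by rewrite muleC -lte_pdivlMr.
- exact: Lfun_measurable (LfunB (Lfun_lin a Lu Lv) (Lfun_linf a Lf Lg)).
- exact: Lfun_measurable (Lfun_linf a LF LG).
- apply: filterS (lin_ae a u v) => p /= h _; rewrite h//= /F /G /=.
  by rewrite -[_ *: _]/(_ * _) -[_ *: _]/(_ * _); ring.
Qed.

Let H10_submod_closed : submod_closed H10_pred.
Proof.
split.
  apply/asboolP; have L0 : ((0 : M) : plane R -> R) \in Lfun mu 2%:E.
    by apply: (eq_ae_Lfun2 (mfunE _) (ae_eq_sym (ae0 mu))); exact: (Lfun_submod_closed mu le12).1.
  have N0 : ('N[mu]_2%:E [EFin \o (((0 : M) : plane R -> R) \- (fun=> 0%R))%R] = 0)%E.
    rewrite (@eq_ae_Lnorm2 _ _ _ mu _ (cst 0)) ?Lnorm0//.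
      by apply: measurable_funB => //; exact: mfunE.
    by apply: filterS (ae0 mu) => p /= h _; rewrite h// subr0.
  have I0 (h : plane R -> R) : h \in Lfun mu 2%:E -> \int[mu]_p ((0 : M) p * h p) = 0.
    move=> hh; rewrite (eq_ae_RintegralM (mfunE _) _ (Lfun_measurable hh) (ae0 mu))//.
    rewrite /Rintegral integral0_eq// => p _ /=; by rewrite mul0r.
  split.
    split=> //= phi tphi; have [L0' L1 L2] := test_function_Lfun2 oOm tphi.
      by rewrite !I0// oppr0.
    by rewrite !I0// oppr0.
  move=> e e0; exists (fun=> 0); first exact: test_function0.
  have P0 (v : R * R) : (fun p : R * R => 'D_v (fun=> 0 : R) p) = fun=> 0.
    by apply/funext => p; exact: derive_cst.
  by rewrite /partial1 /partial2 !P0 /= N0 lte_fin.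
move=> a [[u u1] u2] [[v v1] v2].
move=> /asboolP[[Lu Lu1 Lu2 wu1 wu2] cu] /asboolP[[Lv Lv1 Lv2 wv1 wv2] cv].
rewrite /= in Lu Lu1 Lu2 wu1 wu2 cu Lv Lv1 Lv2 wv1 wv2 cv.
apply/asboolP; split.
  split; [exact: Lfun_lin|exact: Lfun_lin|exact: Lfun_lin| |].
    apply: weak_partial_lin Lu Lu1 Lv Lv1 wu1 wv1 => phi tphi.
    by have [_ L _] := test_function_Lfun2 oOm tphi; exact: L.
  apply: weak_partial_lin Lu Lu2 Lv Lv2 wu2 wv2 => phi tphi.
  by have [_ _ L] := test_function_Lfun2 oOm tphi; exact: L.
move=> e e0.
have e'0 : 0 < e / 2 / (`|a| + 1) by rewrite !divr_gt0// ltr_wpDl.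
have [phi tphi [pa pb pc]] := cu _ e'0.
have [|psi tpsi [qa qb qc]] := cv (e / 2); first by rewrite divr_gt0.
have [L0 L1 L2] := test_function_Lfun2 oOm tphi.
have [K0 K1 K2] := test_function_Lfun2 oOm tpsi.
exists (fun p => a * phi p + psi p); first exact: test_function_lin.
have [-> ->] := test_function_partial_lin a tphi tpsi.
split.
- exact: approx_lin e0 Lu Lv L0 K0 pa qa.
- exact: approx_lin e0 Lu1 Lv1 L1 K1 pb qb.
- exact: approx_lin e0 Lu2 Lv2 L2 K2 pc qc.
Qed.

HB.instance Definition _ :=
  GRing.isSubmodClosed.Build R _ H10_pred H10_submod_closed.

End sobolev.

Section dirichlet_space.
Context {R : realType} (Om : set (R * R)) (oOm : open Om).
Local Notation mu := (lebesgue_on oOm).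
Local Notation M := {mfun_ mu, plane R >-> R}.

Record H10space := MkH10 { H10val :> M * M * M; _ : H10val \in @H10_pred R Om oOm }.
HB.instance Definition _ := [isSub for H10val].
HB.instance Definition _ := [Choice of H10space by <:].
HB.instance Definition _ := [SubChoice_isSubLmodule of H10space by <:].

Definition gradient (u : H10space) (p : plane R) : 'cV[R]_2 :=
  \col_i (if i == 0 then (H10val u).1.2 p else (H10val u).2 p).

Definition dot (a b : 'cV[R]_2) : R := (a^T *m b) 0 0.

Definition H10norm (u : H10space) : R :=
  Num.sqrt (\int[mu]_p dot (gradient u p) (gradient u p)).

Record Hm1space := MkHm1 {
  Hm1val :> H10space -> R;
  _ : scalar Hm1val;
  _ : exists C : R, forall u, `|Hm1val u| <= C * H10norm u }.

End dirichlet_space.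

Section coefficients.
Context {R : realType}.
Implicit Types (Om : set (R * R)) (k : R * R -> R).

Definition diagonal_tensor k1 k2 (p : R * R) : 'M[R]_2 :=
  diag_mx (\row_i (if i == 0 then k1 p else k2 p)).

Definition lebesgue_integrable Om (oOm : open Om) k :=
  exists k0 : plane R -> R,
    (lebesgue_on oOm).-integrable setT (EFin \o k0) /\
    (k : plane R -> R) = k0 %[ae lebesgue_on oOm].

Definition lipschitz_domain Om :=
  forall p, closure Om p -> ~ Om p ->
  exists (c s r : R) (gamma : R -> R),
    [/\ c ^+ 2 + s ^+ 2 = 1, 0 < r, lipschitz gamma &
      forall q, ball p r q ->
        Om q <-> gamma (c * q.1 + s * q.2) < - s * q.1 + c * q.2].
End coefficients.

Section spectrum.
Context {R : realType} (V : lmodType R).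

Definition complexification : Type := (V * V)%type.
HB.instance Definition _ := GRing.Zmodule.on complexification.
Implicit Types (a b : R[i]) (w : complexification).

Definition cscale a w : complexification :=
  (complex.Re a *: w.1 - complex.Im a *: w.2,
   complex.Re a *: w.2 + complex.Im a *: w.1).

Let cscaleA a b w : cscale a (cscale b w) = cscale (a * b) w.
Proof.
case: a b w => [a a'] [b b'] [u v]; rewrite /cscale/=; congr (_, _).
  rewrite !scalerBr !scalerDr !scalerA scalerBl scalerDl.
  by rewrite -!addrA -!opprD; congr (_ - _); rewrite addrA addrC.
rewrite !scalerBr !scalerDr !scalerA scalerBl scalerDl.
by rewrite [X in _ + _ + X = _]addrC addrACA.
Qed.

Let cscale1 : left_id 1 cscale.
Proof. by case=> u v; rewrite /cscale/= !scale1r !scale0r subr0 addr0. Qed.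

Let cscaleDr : right_distributive cscale +%R.
Proof.
move=> [a a'] [u v] [u' v']; rewrite /cscale/=; congr (_, _).
  by rewrite !scalerDr opprD addrACA.
by rewrite !scalerDr addrACA.
Qed.

Let cscaleDl w : {morph cscale^~ w : a b / a + b}.
Proof.
move=> [a a'] [b b']; case: w => u v; rewrite /cscale/=; congr (_, _).
  by rewrite !scalerDl opprD addrACA.
by rewrite !scalerDl addrACA.
Qed.

HB.instance Definition _ := GRing.Zmodule_isLmodule.Build R[i] complexification
  cscaleA cscale1 cscaleDr cscaleDl.

Definition cnorm (N : V -> R) w : R := Num.sqrt (N w.1 ^+ 2 + N w.2 ^+ 2).

Definition cmap (T : V -> V) w : complexification := (T w.1, T w.2).

Definition spectrum (N : V -> R) (T : V -> V) : set R[i] := [set a |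
  ~ exists B : {linear complexification -> complexification},
    [/\ exists C : R, forall w, cnorm N (B w) <= C * cnorm N w,
        cancel (fun w => a *: w - cmap T w) B &
        cancel B (fun w => a *: w - cmap T w)]].

End spectrum.

(* Main.v *)
Require Import Defs.
From HB Require Import structures.
From mathcomp Require Import all_boot all_order all_algebra complex.
From mathcomp Require Import all_classical all_reals all_analysis.
From mathcomp Require Import measurable_realfun ring lra.

Set Implicit Arguments.
Unset Strict Implicit.
Unset Printing Implicit Defensive.

Import Order.TTheory GRing.Theory Num.Theory numFieldNormedType.Exports.

Local Open Scope classical_set_scope.
Local Open Scope ring_scope.

(**
On S the operator r L - A has the constant coefficients m1 = r - c1 and
m2 = r - c2 with m1 m2 <= 0, so it is hyperbolic or degenerate there. For
c = sqrt (- m1 m2) the matrix N = [[m1, c], [-c, m2]] is singular, say N q = 0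
with q != 0, and its antisymmetric part is invisible in the weak form because
the integral of u_x psi_y - u_y psi_x vanishes. Take a bump chi supported in S
and the waves u = chi sin (n q.z), v = chi cos (n q.z). Since N q = 0, one gets
N grad u = sin (n q.z) N grad chi and likewise for v, so the residuals r u - T u
and r v - T v (with T = L^-1 A) have energy at most that of N grad chi, whereas
the energy of the pair (u, v) is at least n^2 |q|^2 times the squared L2 norm of
chi. Hence r - T has no bounded inverse.

Since L^-1 is a pseudo-inverse with default value 0, surjectivity of L is needed
to have L (T u) = A u; the Riesz representation theorem is avoided as follows.
If r - T has a linear inverse then T is additive. If some A u is not in the range
of L, additivity forces T w = 0 for every w such that A w is in the range; but
for f smooth with compact support in S one has A (Laplacian f) = L (c1 f_xx + c2 f_yy),
so this is absurd.
*)

(** * Functions flat at the origin, of the type exp(-1/t) *)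

Section flat.
Context {R : realType}.
Implicit Types (Q : {poly R}) (t s x : R).

(* These functions are closed under derivation: the derivative of [flat Q] is
[flat ((Q - Q') X^2)]. *)
Definition flat Q t : R := if 0 < t then Q.[t^-1] * expR (- t^-1) else 0.

(** Induction on [Q] for all [m] at once: the extra factor [s] is absorbed by passing to [m.+1], and
    the constant term is controlled by the series bound s^(m+1) / (m+1)! <= exp s. *)
Lemma horner_expRN_bounded Q m :
  exists2 C, 0 <= C & forall s, 0 <= s -> `|Q.[s] * s ^+ m * expR (- s)| <= C.
Proof.
elim/poly_ind: Q m => [|Q c IH] m.
  by exists 0 => // s _; rewrite horner0 !mul0r normr0.
have [C C0 HC] := IH m.+1.
exists (C + `|c| * (1 + m.+1`!%:R)).
  by rewrite addr_ge0// mulr_ge0// addr_ge0.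
move=> s s0; rewrite hornerMXaddC.
have -> : (Q.[s] * s + c) * s ^+ m * expR (- s) =
    Q.[s] * s ^+ m.+1 * expR (- s) + c * (s ^+ m * expR (- s)).
  by rewrite exprS; ring.
apply: le_trans (ler_normD _ _) _; apply: lerD; first exact: HC.
rewrite normrM ler_wpM2l//.
rewrite ger0_norm ?mulr_ge0 ?exprn_ge0 ?expR_ge0// expRN ler_pdivrMr ?expR_gt0//.
have f0 : (0 : R) < m.+1`!%:R by rewrite ltr0n fact_gt0.
set E := expR s; set F : R := m.+1`!%:R.
have sF0 : 0 <= s ^+ m.+1 / F by rewrite divr_ge0 ?exprn_ge0// ltW.
have H : 1 + s ^+ m.+1 / F <= E by exact: expR_ge1Dxn.
have [s1|s1] := leP s 1.
  have : s ^+ m <= 1 by rewrite exprn_ile1.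
  by nra.
have sm : s ^+ m <= s ^+ m.+1 by rewrite ler_weXn2l// ltW.
have : s ^+ m.+1 <= E * F by rewrite -ler_pdivrMr//; lra.
by nra.
Qed.

(** The previous bound with m = 2 at s = 1/t; this quadratic decay is what makes the derivative at 0
    exist and vanish. *)
Lemma flat_le_sqr Q : exists2 C, 0 <= C & forall t, `|flat Q t| <= C * t ^+ 2.
Proof.
have [C C0 HC] := horner_expRN_bounded Q 2; exists C => // t; rewrite /flat.
case: ifPn => [t0|_]; last by rewrite normr0 mulr_ge0// sqr_ge0.
have ti : 0 <= t^-1 by rewrite invr_ge0 ltW.
have := HC _ ti.
rewrite mulrAC normrM (ger0_norm (exprn_ge0 2 ti)) exprVn.
by rewrite ler_pdivrMr ?exprn_gt0.
Qed.

Lemma is_derive_flat Q x : is_derive x 1 (flat Q) (flat ((Q - Q^`()) * 'X^2) x).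
Proof.
have [x0|x0|->] := ltgtP x 0.
- rewrite [flat (_ * _) _]/flat ltNge (ltW x0)/=.
  apply: (@near_eq_is_derive _ _ _ (cst 0)).
    near=> z; rewrite /flat ifF//; apply/negbTE; rewrite -leNgt ltW//.
    near: z; exact: lt_nbhsl.
- rewrite [flat (_ * _) _]/flat x0.
  have dV : is_derive x 1 (fun t : R => t^-1) (- x ^- 2).
    have := @is_deriveV R id x 1 1 (lt0r_neq0 x0) (is_derive_id _ _).
    by rewrite /GRing.scale/= mulr1.
  have dQ : is_derive x 1 (horner Q \o (fun t : R => t^-1)) (Q^`().[x^-1] * (- x ^- 2)).
    apply: is_derive_eq; by rewrite mulrC.
  have dE : is_derive x 1 (expR \o (fun t : R => - t^-1)) (expR (- x^-1) * x ^- 2).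
    have dN : is_derive x 1 (fun t : R => - t^-1) (x ^- 2).
      by apply: is_derive_eq; rewrite opprK.
    by apply: is_derive_eq.
  have := is_deriveM dQ dE; rewrite -[_ * _]/(fun t : R => Q.[t^-1] * expR (- t^-1)).
  move=> [h1 h2]; apply: (@near_eq_is_derive _ _ _ (fun t => Q.[t^-1] * expR (- t^-1))).
    by near=> z; rewrite /flat ifT//; near: z; exact: lt_nbhsr.
  apply: DeriveDef h1 _; rewrite h2.
  rewrite hornerM hornerXn hornerD hornerN -exprVn /GRing.scale/=; ring.
- rewrite [flat (_ * _) _]/flat ltxx.
  have [C C0 HC] := flat_le_sqr Q.
  have f0 : flat Q 0 = 0 by rewrite /flat ltxx.
  (* The difference quotient at 0 is dominated by C |z|, hence tends to its value 0 there. *)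
  apply/is_derive1_caratheodory; exists (fun z => flat Q z / z); split.
  - move=> z; have [->|z0] := eqVneq z 0; first by rewrite !subrr mulr0.
    by rewrite f0 !subr0 divfK.
  - rewrite -[prop_for _ _]/(flat Q z / z @[z --> (0 : R)] --> flat Q 0 / 0) f0 mul0r.
    have cC : (fun z : R => C * `|z|) @ (0 : R) --> (0 : R).
      rewrite -[X in _ --> X](mulr0 C); apply: cvgMr.
      by rewrite -[X in _ --> X](@normr0 _ R); exact: norm_continuous.
    apply/norm_cvg0P; apply: squeeze_cvgr (cvg_cst _) cC.
    near=> z; rewrite normr_ge0/= normrM normfV.
    have [->|z0] := eqVneq z 0; first by rewrite normr0 invr0 !mulr0.
    by rewrite ler_pdivrMr ?normr_gt0// -mulrA -expr2 real_normK ?num_real.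
  - by rewrite f0 mul0r.
Unshelve. all: by end_near. Qed.

(** [flat (flat_poly n)] is the n-th derivative of exp(-1/t) extended by 0 to t <= 0. *)
Fixpoint flat_poly n : {poly R} :=
  if n is n'.+1 then (flat_poly n' - (flat_poly n')^`()) * 'X^2 else 1.

Lemma flat0_gt0 t : (0 < flat 1 t) = (0 < t).
Proof.
rewrite /flat; case: ifPn => [_|]; last by rewrite ltxx.
by rewrite hornerC mul1r expR_gt0.
Qed.

End flat.

(** * A class of smooth functions of two variables and its differential calculus *)

Section smooth.
Context {R : realType}.
Implicit Types (F : nat -> R -> R) (f g : R * R -> R) (p v : R * R).

(** [F n] plays the n-th derivative of [F 0]; supplying the whole sequence keeps every derivative
    explicit, and shifting the index differentiates. *)
Definition derivative_chain F := forall n x, is_derive (x : R) 1 (F n) (F n.+1 x).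

(* A class of C^oo functions large enough for the construction, in which closure
under partial derivatives and commutation of mixed partials go by induction. *)
Inductive smooth : (R * R -> R) -> Prop :=
| smooth_ridge F a b c of derivative_chain F :
    smooth (fun p => F 0%N (a * p.1 + b * p.2 + c))
| smoothD f g of smooth f & smooth g : smooth (fun p => f p + g p)
| smoothM f g of smooth f & smooth g : smooth (fun p => f p * g p).

Lemma is_derive_along f p v d :
  is_derive (0 : R) 1 (fun h => f (h *: v + p)) d -> is_derive p v f d.
Proof.
have E : (fun h : R => h^-1 *: ((f \o shift p) (h *: v) - f p)) =
    (fun h : R => h^-1 *: (((fun h : R => f (h *: v + p)) \o shift 0) (h *: 1)
      - f (0 *: v + p))).
  apply/funext => h /=; rewrite scale0r add0r addr0.
  by rewrite [h *: 1]mulr1.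
by move=> [h1 h2]; apply: DeriveDef; [rewrite /derivable E|rewrite /derive E].
Qed.

Lemma is_derive_ridge (G G' : R -> R) a b c p v :
  (forall x : R, is_derive x 1 G (G' x)) ->
  is_derive p v (fun p => G (a * p.1 + b * p.2 + c))
    ((a * v.1 + b * v.2) * G' (a * p.1 + b * p.2 + c)).
Proof.
move=> dG; apply: is_derive_along.
set s := a * v.1 + b * v.2; set t := a * p.1 + b * p.2 + c.
rewrite (_ : (fun h : R => _) = G \o (fun h : R => s * h + t)); last first.
  apply/funext => h; rewrite /s /t /=; congr G.
  case: p v @s @t => [p1 p2] [v1 v2] /=.
  rewrite -[h *: v1]/(h * v1) -[h *: v2]/(h * v2).
  ring.
have dl : is_derive (0 : R) 1 (fun h : R => s * h + t) s.
  have dZ : is_derive (0 : R) (1 : R) (fun h : R => s * h) s.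
    by have := is_deriveZ s (is_derive_id (0 : R) (1 : R)); rewrite [s *: 1]mulr1.
  by have := is_deriveD dZ (is_derive_cst t (0 : R) (1 : R)); rewrite addr0.
have dt : is_derive ((fun h : R => s * h + t) 0) 1 G (G' t).
  by rewrite mulr0 add0r.
by have := @is_derive1_comp R G (fun h => s * h + t) 0 (G' t) s dt dl; rewrite mulrC.
Qed.

Lemma continuous_ridge (G : R -> R) a b c : continuous G ->
  continuous (fun p : R * R => G (a * p.1 + b * p.2 + c)).
Proof.
move=> cG p; apply: (@continuous_comp _ _ _ (fun p : R * R => a * p.1 + b * p.2 + c) G);
  last exact: cG.
apply: cvgD; last exact: cvg_cst.
by apply: cvgD; apply: cvgMr; [exact: cvg_fst|exact: cvg_snd].
Qed.

Lemma smooth_cst c : smooth (fun=> c).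
Proof.
have dc : derivative_chain (fun n (_ : R) => if n is 0%N then c else 0).
  by case=> [|n] x; exact: is_derive_cst.
exact: smooth_ridge 0 0 0 dc.
Qed.

Lemma affine_chain :
  derivative_chain (fun n (x : R) => if n is 0%N then x else if n is 1%N then 1 else 0).
Proof.
by case=> [|[|n]] x; [exact: is_derive_id|exact: is_derive_cst|exact: is_derive_cst].
Qed.

Lemma smooth_sub1 a : smooth (fun p => p.1 - a).
Proof.
have := smooth_ridge 1 0 (- a) affine_chain.
by under eq_fun do rewrite mul1r mul0r addr0.
Qed.

Lemma smooth_sub2 a : smooth (fun p => p.2 - a).
Proof.
have := smooth_ridge 0 1 (- a) affine_chain.
by under eq_fun do rewrite mul1r mul0r add0r.
Qed.

Lemma smooth_scale c f : smooth f -> smooth (fun p => c * f p).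
Proof. exact: smoothM (smooth_cst c). Qed.

(** The derivatives are produced as members of the class together with the differentiation rules,
    since the induction on products needs both; [partial1] and [partial2] are identified with them
    afterwards. *)
Lemma smooth_derive f : smooth f -> exists f1 f2, [/\ smooth f1, smooth f2,
  forall p, is_derive p (1, 0) f (f1 p), forall p, is_derive p (0, 1) f (f2 p) &
  continuous f].
Proof.
elim=> [F a b c dF|{}f g sf [f1 [f2 [s1 s2 d1 d2 cf]]] sg [g1 [g2 [t1 t2 e1 e2 cg]]]
  |{}f g sf [f1 [f2 [s1 s2 d1 d2 cf]]] sg [g1 [g2 [t1 t2 e1 e2 cg]]]].
- have sF' : smooth (fun p => F 1%N (a * p.1 + b * p.2 + c)).
    by apply: (@smooth_ridge (fun n => F n.+1)) => n; exact: dF.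
  exists (fun p => a * F 1%N (a * p.1 + b * p.2 + c)),
         (fun p => b * F 1%N (a * p.1 + b * p.2 + c)).
  split; try exact: smooth_scale.
  + move=> p; have := @is_derive_ridge _ _ a b c p (1, 0) (dF 0%N).
    by rewrite /= mulr1 mulr0 addr0.
  + move=> p; have := @is_derive_ridge _ _ a b c p (0, 1) (dF 0%N).
    by rewrite /= mulr1 mulr0 add0r.
  + apply: continuous_ridge => x; apply: differentiable_continuous.
    by apply/derivable1_diffP; exact: ex_derive.
- exists (fun p => f1 p + g1 p), (fun p => f2 p + g2 p); split.
  + exact: smoothD.
  + exact: smoothD.
  + by move=> p; exact: is_deriveD.
  + by move=> p; exact: is_deriveD.
  + by move=> p; apply: cvgD; [exact: cf|exact: cg].
- exists (fun p => f1 p * g p + f p * g1 p), (fun p => f2 p * g p + f p * g2 p); split.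
  + by apply: smoothD; exact: smoothM.
  + by apply: smoothD; exact: smoothM.
  + move=> p; have := is_deriveM (d1 p) (e1 p).
    by rewrite /GRing.scale/= addrC [g p * _]mulrC.
  + move=> p; have := is_deriveM (d2 p) (e2 p).
    by rewrite /GRing.scale/= addrC [g p * _]mulrC.
  + by move=> p; apply: cvgM; [exact: cf|exact: cg].
Qed.

Lemma smooth_continuous f : smooth f -> continuous f.
Proof. by case/smooth_derive => f1 [f2 []]. Qed.

Lemma smooth_derivable1 f p : smooth f -> is_derive p (1, 0) f (partial1 f p).
Proof. by case/smooth_derive => f1 [f2 [_ _ /(_ p) [h _] _ _]]; exact: derivableP. Qed.

Lemma smooth_derivable2 f p : smooth f -> is_derive p (0, 1) f (partial2 f p).
Proof. by case/smooth_derive => f1 [f2 [_ _ _ /(_ p) [h _] _]]; exact: derivableP. Qed.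

Lemma smooth_partial1 f : smooth f -> smooth (partial1 f).
Proof.
case/smooth_derive => f1 [f2 [s1 _ d1 _ _]].
by rewrite (_ : partial1 f = f1)//; apply/funext => p; have [_] := d1 p.
Qed.

Lemma smooth_partial2 f : smooth f -> smooth (partial2 f).
Proof.
case/smooth_derive => f1 [f2 [_ s2 _ d2 _]].
by rewrite (_ : partial2 f = f2)//; apply/funext => p; have [_] := d2 p.
Qed.

Lemma smooth_Ck k f : smooth f -> Ck k f.
Proof.
elim: k f => [|k IH] f sf /=; first exact: smooth_continuous.
split.
- exact: smooth_continuous.
- by move=> p; have [] := smooth_derivable1 p sf.
- by move=> p; have [] := smooth_derivable2 p sf.
- exact/IH/smooth_partial1.
- exact/IH/smooth_partial2.
Qed.

Lemma partial1D f g : smooth f -> smooth g ->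
  partial1 (fun p => f p + g p) = (fun p => partial1 f p + partial1 g p).
Proof.
move=> sf sg; apply/funext => p.
by have [_] := is_deriveD (smooth_derivable1 p sf) (smooth_derivable1 p sg).
Qed.

Lemma partial2D f g : smooth f -> smooth g ->
  partial2 (fun p => f p + g p) = (fun p => partial2 f p + partial2 g p).
Proof.
move=> sf sg; apply/funext => p.
by have [_] := is_deriveD (smooth_derivable2 p sf) (smooth_derivable2 p sg).
Qed.

Lemma partial1M f g : smooth f -> smooth g ->
  partial1 (fun p => f p * g p) = (fun p => partial1 f p * g p + f p * partial1 g p).
Proof.
move=> sf sg; apply/funext => p.
have [_ E] := is_deriveM (smooth_derivable1 p sf) (smooth_derivable1 p sg).
rewrite -[LHS]/('D_(1, 0) (f * g) p) E.
by rewrite /GRing.scale/= addrC [g p * _]mulrC.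
Qed.

Lemma partial2M f g : smooth f -> smooth g ->
  partial2 (fun p => f p * g p) = (fun p => partial2 f p * g p + f p * partial2 g p).
Proof.
move=> sf sg; apply/funext => p.
have [_ E] := is_deriveM (smooth_derivable2 p sf) (smooth_derivable2 p sg).
rewrite -[LHS]/('D_(0, 1) (f * g) p) E.
by rewrite /GRing.scale/= addrC [g p * _]mulrC.
Qed.

Lemma partial1_ridge (G G' : R -> R) a b c : (forall x : R, is_derive x 1 G (G' x)) ->
  partial1 (fun p => G (a * p.1 + b * p.2 + c)) =
  (fun p => a * G' (a * p.1 + b * p.2 + c)).
Proof.
move=> dG; apply/funext => p; have [_] := is_derive_ridge a b c p (1, 0) dG.
by rewrite /= mulr1 mulr0 addr0.
Qed.

Lemma partial2_ridge (G G' : R -> R) a b c : (forall x : R, is_derive x 1 G (G' x)) ->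
  partial2 (fun p => G (a * p.1 + b * p.2 + c)) =
  (fun p => b * G' (a * p.1 + b * p.2 + c)).
Proof.
move=> dG; apply/funext => p; have [_] := is_derive_ridge a b c p (0, 1) dG.
by rewrite /= mulr1 mulr0 add0r.
Qed.

Lemma partialZ c f : smooth f ->
  partial1 (fun p => c * f p) = (fun p => c * partial1 f p) /\
  partial2 (fun p => c * f p) = (fun p => c * partial2 f p).
Proof.
move=> sf; split; apply/funext => p.
  by have [_] := is_deriveZ c (smooth_derivable1 p sf).
by have [_] := is_deriveZ c (smooth_derivable2 p sf).
Qed.

Lemma partial1_lin c d f g : smooth f -> smooth g ->
  partial1 (fun p => c * f p + d * g p) = (fun p => c * partial1 f p + d * partial1 g p).
Proof.
move=> sf sg; rewrite (partial1D (smooth_scale c sf) (smooth_scale d sg)).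
by rewrite (partialZ c sf).1 (partialZ d sg).1.
Qed.

Lemma partial2_lin c d f g : smooth f -> smooth g ->
  partial2 (fun p => c * f p + d * g p) = (fun p => c * partial2 f p + d * partial2 g p).
Proof.
move=> sf sg; rewrite (partial2D (smooth_scale c sf) (smooth_scale d sg)).
by rewrite (partialZ c sf).2 (partialZ d sg).2.
Qed.

(** On a ridge function both mixed derivatives are a b F''; sums and products inherit the symmetry
    by linearity and the Leibniz rule. *)
Lemma smooth_schwarz f : smooth f -> partial1 (partial2 f) = partial2 (partial1 f).
Proof.
elim=> [F a b c dF|{}f g sf IHf sg IHg|{}f g sf IHf sg IHg].
- have dF1 (x : R) : is_derive x 1 (F 1%N) (F 2%N x) by exact: dF.
  have sF' : smooth (fun p => F 1%N (a * p.1 + b * p.2 + c)).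
    by apply: (@smooth_ridge (fun n => F n.+1)) => n; exact: dF.
  have E1 := partial1_ridge a b c (dF 0%N); have E2 := partial2_ridge a b c (dF 0%N).
  have E21 := partial1_ridge a b c dF1; have E12 := partial2_ridge a b c dF1.
  rewrite E1 E2 (partialZ b sF').1 (partialZ a sF').2 E21 E12.
  by apply/funext => p; rewrite mulrCA.
- have [sf1 sf2] := (smooth_partial1 sf, smooth_partial2 sf).
  have [sg1 sg2] := (smooth_partial1 sg, smooth_partial2 sg).
  by rewrite (partial2D sf sg) (partial1D sf sg) (partial1D sf2 sg2)
    (partial2D sf1 sg1) IHf IHg.
- have [sf1 sf2] := (smooth_partial1 sf, smooth_partial2 sf).
  have [sg1 sg2] := (smooth_partial1 sg, smooth_partial2 sg).
  rewrite (partial2M sf sg) (partial1M sf sg).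
  rewrite (partial1D (smoothM sf2 sg) (smoothM sf sg2)).
  rewrite (partial2D (smoothM sf1 sg) (smoothM sf sg1)).
  rewrite (partial1M sf2 sg) (partial1M sf sg2) (partial2M sf1 sg) (partial2M sf sg1).
  by rewrite IHf IHg; apply/funext => p; exact: addrACA.
Qed.

Lemma smooth_schwarz4 f : smooth f ->
  partial1 (partial1 (partial2 (partial2 f))) = partial2 (partial2 (partial1 (partial1 f))).
Proof.
move=> sf; have [sf1 sf2] := (smooth_partial1 sf, smooth_partial2 sf).
apply: etrans (congr1 partial1 (smooth_schwarz sf2)) _.
apply: etrans (smooth_schwarz (smooth_partial1 sf2)) _; apply: congr1.
apply: etrans (congr1 partial1 (smooth_schwarz sf)) _.
exact: smooth_schwarz.
Qed.

(** * Powers of a coordinate, for prescribing derivatives at a point *)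

Lemma smooth_expr1 a n : smooth (fun p => (p.1 - a) ^+ n).
Proof.
elim: n => [|n IH]; first exact: smooth_cst.
by under eq_fun do rewrite exprS; apply: smoothM IH; exact: smooth_sub1.
Qed.

Lemma smooth_expr2 a n : smooth (fun p => (p.2 - a) ^+ n).
Proof.
elim: n => [|n IH]; first exact: smooth_cst.
by under eq_fun do rewrite exprS; apply: smoothM IH; exact: smooth_sub2.
Qed.

Lemma is_derive_expr n (x : R) : is_derive x 1 (fun x : R => x ^+ n) (n%:R * x ^+ n.-1).
Proof.
have := is_deriveX n (is_derive_id x (1 : R)); rewrite [_ *: 1]mulr1.
by rewrite (_ : id ^+ n = fun x : R => x ^+ n)// exprfctE.
Qed.

Lemma partial_expr1 a n : partial1 (fun p => (p.1 - a) ^+ n) = (fun p => n%:R * (p.1 - a) ^+ n.-1)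
  /\ partial2 (fun p => (p.1 - a) ^+ n) = (fun=> 0).
Proof.
have E1 := partial1_ridge 1 0 (- a) (is_derive_expr n).
have E2 := partial2_ridge 1 0 (- a) (is_derive_expr n).
have E : (fun p : R * R => (1 * p.1 + 0 * p.2 - a) ^+ n) = (fun p => (p.1 - a) ^+ n).
  by apply/funext => p; rewrite mul1r mul0r addr0.
rewrite E in E1; rewrite E in E2; rewrite E1 E2.
by split; apply/funext => p; rewrite mul0r// !mul1r addr0.
Qed.

Lemma partial_expr2 a n : partial1 (fun p => (p.2 - a) ^+ n) = (fun=> 0)
  /\ partial2 (fun p => (p.2 - a) ^+ n) = (fun p => n%:R * (p.2 - a) ^+ n.-1).
Proof.
have E1 := partial1_ridge 0 1 (- a) (is_derive_expr n).
have E2 := partial2_ridge 0 1 (- a) (is_derive_expr n).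
have E : (fun p : R * R => (0 * p.1 + 1 * p.2 - a) ^+ n) = (fun p => (p.2 - a) ^+ n).
  by apply/funext => p; rewrite mul1r mul0r add0r.
rewrite E in E1; rewrite E in E2; rewrite E1 E2.
by split; apply/funext => p; rewrite mul0r// !mul1r add0r.
Qed.

(** The factor [1 *] keeps the result in the form [c * f p + d * g p] expected by [partial1_lin], so
    that the rule can be iterated. *)
Lemma partial1_expr1M a n g : smooth g ->
  partial1 (fun p => (p.1 - a) ^+ n * g p) =
  (fun p => n%:R * ((p.1 - a) ^+ n.-1 * g p) + 1 * ((p.1 - a) ^+ n * partial1 g p)).
Proof.
move=> sg; rewrite (partial1M (smooth_expr1 a n) sg) (partial_expr1 a n).1.
by apply/funext => p; rewrite mul1r mulrA.
Qed.

Lemma partial2_expr1M a n g : smooth g ->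
  partial2 (fun p => (p.1 - a) ^+ n * g p) = (fun p => (p.1 - a) ^+ n * partial2 g p).
Proof.
move=> sg; rewrite (partial2M (smooth_expr1 a n) sg) (partial_expr1 a n).2.
by apply/funext => p; rewrite mul0r add0r.
Qed.

Lemma partial2_expr2M a n g : smooth g ->
  partial2 (fun p => (p.2 - a) ^+ n * g p) =
  (fun p => n%:R * ((p.2 - a) ^+ n.-1 * g p) + 1 * ((p.2 - a) ^+ n * partial2 g p)).
Proof.
move=> sg; rewrite (partial2M (smooth_expr2 a n) sg) (partial_expr2 a n).2.
by apply/funext => p; rewrite mul1r mulrA.
Qed.

Lemma partial1_expr2M a n g : smooth g ->
  partial1 (fun p => (p.2 - a) ^+ n * g p) = (fun p => (p.2 - a) ^+ n * partial1 g p).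
Proof.
move=> sg; rewrite (partial1M (smooth_expr2 a n) sg) (partial_expr2 a n).1.
by apply/funext => p; rewrite mul0r add0r.
Qed.

End smooth.

(** * Compact supports and bump functions *)

Section supported.
Context {R : realType}.
Implicit Types (f g : R * R -> R) (p z : R * R) (B Om : set (R * R)).

(** With a fixed closed [B], a function, its derivatives and its products all share the same set. *)
Definition supported B f := forall p, ~ B p -> f p = 0.

Lemma supported_derive B f v : closed B -> supported B f ->
  supported B (fun p => 'D_v f p).
Proof.
move=> cB f0 p Bp; rewrite (@near_eq_derive _ _ _ f (cst 0) p) ?derive_cst//.
have : nbhs p (~` B) by apply: open_nbhs_nbhs; split=> //; exact: closed_openC.
by apply: filterS => q Bq; exact: f0.
Qed.

Lemma compact_closed2 B : compact B -> closed B.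
Proof. by apply: compact_closed; exact: norm_hausdorff. Qed.

Lemma smooth_test_function Om B f : smooth f -> compact B -> B `<=` Om ->
  supported B f -> test_function Om f.
Proof.
move=> sf cB BO f0.
have sub : closure [set p | f p != 0] `<=` B.
  have /closure_id -> : closed B by exact: compact_closed2.
  apply: closureS => p /= fp; apply: contrapT => /f0 e.
  by rewrite e eqxx in fp.
split.
- by move=> k; exact: smooth_Ck.
- by apply: subclosed_compact cB sub; exact: closed_closure.
- by move=> p /sub /BO.
Qed.

Lemma supportedMl B f g : supported B f -> supported B (fun p => f p * g p).
Proof. by move=> f0 p /f0 ->; rewrite mul0r. Qed.

Lemma flat_chain : derivative_chain (fun n => @flat R (flat_poly n)).
Proof. by move=> n x; exact: is_derive_flat. Qed.

(** The n-th derivative shifts the phase by n pi / 2; the same chain started at index 1 yields the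
    cosine. *)
Lemma sin_chain : derivative_chain (fun n x => @sin R (x + n%:R * (pi / 2))).
Proof.
move=> n x.
have dl : is_derive (x : R) (1 : R) (fun x : R => x + n%:R * (pi / 2)) 1.
  by have := is_deriveD (is_derive_id x (1 : R)) (is_derive_cst (n%:R * (pi / 2)) x (1 : R));
    rewrite addr0.
have := @is_derive1_comp R sin (fun x => x + n%:R * (pi / 2)) x _ 1 (is_derive_sin _) dl.
rewrite mulr1 -sinDpihalf.
by have <- : x + n.+1%:R * (pi / 2) = x + n%:R * (pi / 2) + pi / 2
  by rewrite -addrA -natr1 [(n%:R + 1) * _]mulrDl mul1r.
Qed.

Lemma smooth_sin a b c : smooth (fun p : R * R => sin (a * p.1 + b * p.2 + c)).
Proof.
have := smooth_ridge a b c sin_chain.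
by under eq_fun do rewrite mul0r addr0.
Qed.

Lemma smooth_cos a b c : smooth (fun p : R * R => cos (a * p.1 + b * p.2 + c)).
Proof.
have := smooth_ridge a b c (fun n => sin_chain n.+1).
by under eq_fun do rewrite mul1r sinDpihalf.
Qed.

(** A product of four flat ridge functions, one for each side of a square centred at [z], each
    vanishing beyond its side. *)
Lemma smooth_bump (S : set (R * R)) z : open S -> S z ->
  exists (B : set (R * R)) chi,
    [/\ compact B, B `<=` S, smooth chi, supported B chi & 0 < chi z].
Proof.
move=> oS Sz; have /nbhs_ballP[e /= e0 eS] : nbhs z S by exact: open_nbhs_nbhs.
(* Half the radius, so that the closed square lies in the open ball of the maximum norm. *)
pose d := e / 2; have d0 : 0 < d by rewrite divr_gt0.
pose w (a b c : R) p := flat 1 (a * p.1 + b * p.2 + c).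
have sw a b c : smooth (w a b c) by exact: smooth_ridge flat_chain.
have w0 a b c p : a * p.1 + b * p.2 + c <= 0 -> w a b c p = 0.
  by rewrite /w /flat ltNge => ->.
exists (`[z.1 - d, z.1 + d] `*` `[z.2 - d, z.2 + d]),
  (fun p => w 1 0 (d - z.1) p * w (-1) 0 (d + z.1) p
          * (w 0 1 (d - z.2) p * w 0 (-1) (d + z.2) p)); split.
- by apply: compact_setX; exact: segment_compact.
- move=> [x y] [/=]; rewrite !in_itv /= -!ler_distl => hx hy; apply: eS.
  have de : d < e by rewrite ltr_pdivrMr// ltr_pMr// ltr1n.
  by split; rewrite /ball/= distrC; [apply: le_lt_trans hx de|apply: le_lt_trans hy de].
- by apply: smoothM; apply: smoothM; exact: sw.
- move=> [x y] nB.
  have : [\/ x <= z.1 - d, z.1 + d <= x, y <= z.2 - d | z.2 + d <= y].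
    have [|h1] := leP x (z.1 - d); first by constructor 1.
    have [|h2] := leP (z.1 + d) x; first by constructor 2.
    have [|h3] := leP y (z.2 - d); first by constructor 3.
    have [|h4] := leP (z.2 + d) y; first by constructor 4.
    by case: nB; split; rewrite /= in_itv/= !ltW.
  case=> h.
  + by rewrite (w0 1) ?mul0r//=; lra.
  + by rewrite (w0 (-1)) ?mulr0 ?mul0r//=; lra.
  + by rewrite (w0 0 1) ?mul0r ?mulr0//=; lra.
  + by rewrite (w0 0 (-1)) ?mulr0//=; lra.
- by rewrite !mulr_gt0// /w flat0_gt0; lra.
Qed.

End supported.

(** * Vanishing integrals of derivatives with compact support *)

Section integration.
Context {R : realType}.
Implicit Types (f g h : R * R -> R) (p z : R * R) (B Om : set (R * R)).
Local Notation leb := (@lebesgue_measure R).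

Lemma compact_lt_bound B : compact B ->
  exists2 M : R, 0 < M & forall p, B p -> `|p.1| < M /\ `|p.2| < M.
Proof.
move=> /compact_bounded/ex_strict_bound_gt0 [M M0 KM]; exists M => // p /KM.
by rewrite /= prod_normE /= gt_max => /andP[].
Qed.

Lemma integrable_supported f B : continuous f -> compact B ->
  (forall p, ~ B p -> f p = 0) ->
  (@lebesgue2 R).-integrable setT (EFin \o (f : plane R -> R)).
Proof.
move=> cf cB f0; have [mB Bfin] := compact_lebesgue2 cB.
have mf := continuous_measurable2 cf.
have iB : (@lebesgue2 R).-integrable (B : set (plane R)) (EFin \o (f : plane R -> R)).
  apply: measurable_bounded_integrable => //.
    exact: measurable_funS mf.
  have := continuous_compact (continuous_subspaceT cf) cB.
  move=> /compact_bounded [M [Mr HM]]; exists M; split=> // x Mx p Bp.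
  by apply: HM => //; exists p.
have /(integrable_mkcond _ mB) := iB; apply: eq_integrable => // p _.
by rewrite /patch; case: ifPn => //= /negP pB; rewrite f0// => /mem_set.
Qed.

Lemma integral_deriv_supported (F f : R -> R) (M : R) : 0 < M ->
  (forall x, is_derive x (1 : R) F (f x)) -> continuous f ->
  (forall x, M <= `|x| -> F x = 0) -> (forall x, M <= `|x| -> f x = 0) ->
  (\int[leb]_x (f x)%:E = 0)%E.
Proof.
move=> M0 dF cf F0 f0.
transitivity (\int[leb]_(x in `[(- M)%R, M]) (f x)%:E)%E.
  rewrite [RHS]integral_mkcond; apply: eq_integral => x _.
  rewrite /patch; case: ifPn => //; rewrite notin_setE /= in_itv/= -ler_norml => /negP.
  by rewrite -ltNge => /ltW /f0 ->.
have cF : continuous F.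
  move=> x; apply: differentiable_continuous.
  by apply/derivable1_diffP; exact: ex_derive.
rewrite (@continuous_FTC2 _ f F); first last.
- by move=> x _; rewrite derive1E; have [_] := dF x.
- split.
  + by move=> x _; exact: ex_derive.
  + by apply: cvg_at_right_filter; exact: cF.
  + by apply: cvg_at_left_filter; exact: cF.
- exact: continuous_subspaceT.
- by rewrite gtrN.
by rewrite !F0 ?normrN ?gtr0_norm// subee.
Qed.

Lemma continuous_slice1 f y : continuous f -> continuous (fun x => f (x, y)).
Proof.
move=> cf x; apply: (@continuous_comp _ _ _ (fun x => (x, y)) f); last exact: cf.
exact: (@cvg_pair _ _ _ (nbhs x) (nbhs x) (nbhs y) _ _ _ id (cst y) cvg_id (@cvg_cst _ _ _ _ _)).
Qed.

Lemma continuous_slice2 f x : continuous f -> continuous (fun y => f (x, y)).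
Proof.
move=> cf y; apply: (@continuous_comp _ _ _ (fun y => (x, y)) f); last exact: cf.
exact: (@cvg_pair _ _ _ (nbhs y) (nbhs x) (nbhs y) _ _ _ (cst x) id (cvg_cst _) cvg_id).
Qed.

Lemma is_derive_slice1 f y x d :
  is_derive (x, y) ((1, 0) : R * R) f d -> is_derive x (1 : R) (fun x => f (x, y)) d.
Proof.
have E : (fun h : R => h^-1 *: ((f \o shift (x, y)) (h *: (1, 0)) - f (x, y))) =
    (fun h : R => h^-1 *: (((fun x => f (x, y)) \o shift x) (h *: 1) - f (x, y))).
  apply/funext => h /=; congr (_ *: (f _ - _)).
  by congr (_, _) => /=; rewrite scaler0 add0r.
move=> [h1 h2]; apply: DeriveDef; first by rewrite /derivable -E.
by rewrite /derive -E.
Qed.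

Lemma is_derive_slice2 f y x d :
  is_derive (x, y) ((0, 1) : R * R) f d -> is_derive y (1 : R) (fun y => f (x, y)) d.
Proof.
have E : (fun h : R => h^-1 *: ((f \o shift (x, y)) (h *: (0, 1)) - f (x, y))) =
    (fun h : R => h^-1 *: (((fun y => f (x, y)) \o shift y) (h *: 1) - f (x, y))).
  apply/funext => h /=; congr (_ *: (f _ - _)).
  by congr (_, _) => /=; rewrite scaler0 add0r.
move=> [h1 h2]; apply: DeriveDef; first by rewrite /derivable -E.
by rewrite /derive -E.
Qed.

(** By Fubini the variable of differentiation is integrated first, and each slice contributes
    zero. *)
Lemma integral_partial1 f f' B : (forall p, is_derive p ((1, 0) : R * R) f (f' p)) ->
  continuous f' -> compact B -> (forall p, ~ B p -> f p = 0) ->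
  (forall p, ~ B p -> f' p = 0) ->
  (\int[@lebesgue2 R]_p (f' p)%:E = 0)%E.
Proof.
move=> df cf' cB f0 f'0; have [M M0 BM] := compact_lt_bound cB.
rewrite /lebesgue2 -integral21_prod_meas1; last exact: integrable_supported cf' cB f'0.
apply: integral0_eq => y _.
apply: (@integral_deriv_supported (fun x => f (x, y)) (fun x => f' (x, y)) M M0).
- by move=> x; exact: is_derive_slice1.
- exact: continuous_slice1.
- by move=> x Mx; apply: f0 => /BM[/=]; rewrite ltNge Mx.
- by move=> x Mx; apply: f'0 => /BM[/=]; rewrite ltNge Mx.
Qed.

Lemma integral_partial2 f f' B : (forall p, is_derive p ((0, 1) : R * R) f (f' p)) ->
  continuous f' -> compact B -> (forall p, ~ B p -> f p = 0) ->
  (forall p, ~ B p -> f' p = 0) ->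
  (\int[@lebesgue2 R]_p (f' p)%:E = 0)%E.
Proof.
move=> df cf' cB f0 f'0; have [M M0 BM] := compact_lt_bound cB.
rewrite /lebesgue2 -integral12_prod_meas1; last exact: integrable_supported cf' cB f'0.
apply: integral0_eq => x _.
apply: (@integral_deriv_supported (fun y => f (x, y)) (fun y => f' (x, y)) M M0).
- by move=> y; exact: is_derive_slice2.
- exact: continuous_slice2.
- by move=> y My; apply: f0 => /BM[_ /=]; rewrite ltNge My.
- by move=> y My; apply: f'0 => /BM[_ /=]; rewrite ltNge My.
Qed.

Lemma integral_lebesgue_on Om (oOm : open Om) (f : plane R -> \bar R) :
  (forall p, ~ Om p -> f p = 0%E) ->
  (\int[lebesgue_on oOm]_p f p = \int[@lebesgue2 R]_p f p)%E.
Proof.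
move=> f0; have E (m : {measure set (plane R) -> \bar R}) :
    (\int[m]_p f p = \int[m]_(p in (Om : set (plane R))) f p)%E.
  rewrite [RHS]integral_mkcond; apply: eq_integral => p _.
  by rewrite /patch; case: ifPn => // /negP pO; rewrite f0// => /mem_set.
rewrite !E; apply: eq_measure_integral => A mA AO.
by rewrite -[LHS]/(lebesgue2 (A `&` Om)) setIidl.
Qed.

End integration.

(** * Almost everywhere equality for integrals of arbitrary functions *)

Section ae_integral.
Context d (T : measurableType d) (R : realType) (mu : {measure set T -> \bar R}).
Import HBNNSimple.
Local Open Scope ereal_scope.

(** A simple function below [F] is set to zero on a null set outside which [F] and [G] agree: it is
    then below [G], and its integral is unchanged. *)
Let ereal_sup_sintegral_le (F G : T -> \bar R) :
  (forall x, 0 <= G x) -> {ae mu, forall x, F x = G x} ->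
  ereal_sup [set sintegral mu h | h in [set h : {nnsfun T >-> R} | forall x, (h x)%:E <= F x]]
  <= ereal_sup [set sintegral mu h | h in [set h : {nnsfun T >-> R} | forall x, (h x)%:E <= G x]].
Proof.
move=> G0 [N [mN N0 FGN]]; apply: ge_ereal_sup => _ [h /= hF <-].
apply: ereal_sup_ubound; exists (proj_nnsfun h (measurableC mN)) => /=.
  move=> x; rewrite mindicE; have [xN|xN] := boolP (x \in ~` N).
    rewrite mulr1; have -> : G x = F x; last exact: hF.
    apply: contrapT => e; move/set_mem: xN; apply; apply: FGN => /=.
    by move=> h'; apply: e; rewrite h'.
  by rewrite mulr0.
have := integral_nnsfun mu measurableT (proj_nnsfun h (measurableC mN)).
have := integral_nnsfun mu measurableT h.
rewrite !patch_setT => <- <-.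
apply: ae_eq_integral; first exact: measurableT.
- exact/measurable_EFinP/(measurable_funPT (proj_nnsfun h (measurableC mN))).
- exact/measurable_EFinP/(measurable_funPT h).
exists N; split=> // x /= hx; apply: contrapT => xN; apply: hx => _.
by rewrite mindicE mem_set// mulr1.
Qed.

(* The coefficients k1 and k2 are only a.e. equal to measurable functions, hence
no measurability assumption here. *)
Lemma ae_eq_integral_nonmeasurable (f g : T -> \bar R) :
  f = g %[ae mu] -> \int[mu]_x f x = \int[mu]_x g x.
Proof.
move=> fg; rewrite /integral !patch_setT.
congr (_ - _); apply/eqP; rewrite eq_le; apply/andP; split;
  apply: ereal_sup_sintegral_le => //; apply: filterS fg => x /= h;
  by rewrite ?funeposE ?funenegE h.
Qed.

End ae_integral.

(** * The real L2 pairing *)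

Section L2_pairing.
Context d (T : measurableType d) (R : realType) (mu : {measure set T -> \bar R}).
Implicit Types f g h : T -> R.

Definition pairing f g : R := \int[mu]_x (f x * g x).
Local Notation L2 := (Lfun mu 2%:E).

Lemma pairingC f g : pairing f g = pairing g f.
Proof. by apply: eq_Rintegral => x _; rewrite mulrC. Qed.

Lemma integrable_pairing f g : f \in L2 -> g \in L2 ->
  mu.-integrable setT (EFin \o (fun x => f x * g x)).
Proof. by move=> hf hg; apply/Lfun1_integrable; exact: Lfun2_mul_Lfun1. Qed.

Lemma Lfun2_lin a b f g : f \in L2 -> g \in L2 -> (fun x => a * f x + b * g x) \in L2.
Proof.
have le12 : (1 <= (2 : R)%:E :> \bar R)%E by rewrite lee_fin ler1n.
move=> hf hg; have [h0 hl] := Lfun_submod_closed mu le12.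
have := hl a f _ hf (hl b g 0 hg h0).
by rewrite (_ : _ + _ = fun x => a * f x + b * g x)//; apply/funext => x; rewrite !fctE addr0.
Qed.

Lemma pairing_linl a b f g h : f \in L2 -> g \in L2 -> h \in L2 ->
  pairing (fun x => a * f x + b * g x) h = a * pairing f h + b * pairing g h.
Proof.
move=> hf hg hh.
have i1 := integrable_pairing hf hh; have i2 := integrable_pairing hg hh.
rewrite /pairing -RintegralZl// -RintegralZl// -RintegralD//.
- by apply: eq_Rintegral => x _ /=; rewrite mulrDl !mulrA.
- have := integrableZl measurableT a i1.
  by apply: eq_integrable => // x _ /=; rewrite EFinM.
- have := integrableZl measurableT b i2.
  by apply: eq_integrable => // x _ /=; rewrite EFinM.
Qed.

Lemma pairing_ge0 f : 0 <= pairing f f.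
Proof. by apply: Rintegral_ge0 => x _; rewrite -expr2 sqr_ge0. Qed.

(** Expansion of the nonnegative square of f - g; it replaces the Cauchy-Schwarz inequality in the
    energy estimate. *)
Lemma pairing_AMGM f g : f \in L2 -> g \in L2 ->
  2 * pairing f g <= pairing f f + pairing g g.
Proof.
move=> hf hg; have hfg := Lfun2_lin 1 (-1) hf hg.
have := pairing_ge0 (fun x => 1 * f x + -1 * g x).
rewrite pairing_linl// !(pairingC _ (fun x => 1 * f x + _)) !pairing_linl//.
by rewrite (pairingC g f); lra.
Qed.

Lemma ae_pairing f g h : f \in L2 -> g \in L2 -> h \in L2 -> f = g %[ae mu] ->
  pairing f h = pairing g h.
Proof.
by move=> /Lfun_measurable mf /Lfun_measurable mg /Lfun_measurable mh;
  exact: eq_ae_RintegralM.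
Qed.

Lemma pairingZ a f : f \in L2 ->
  pairing (fun x => a * f x) (fun x => a * f x) = a ^+ 2 * pairing f f.
Proof.
move=> hf; rewrite /pairing -RintegralZl//; last exact: integrable_pairing.
by apply: eq_Rintegral => x _; rewrite /= expr2 mulrACA.
Qed.

Lemma pairing_le_add f g h : f \in L2 -> g \in L2 -> h \in L2 ->
  (forall x, f x ^+ 2 <= g x ^+ 2 + h x ^+ 2) ->
  pairing f f <= pairing g g + pairing h h.
Proof.
move=> hf hg hh H; have [ig ih] := (integrable_pairing hg hg, integrable_pairing hh hh).
rewrite /pairing -RintegralD//; apply: le_Rintegral => //.
- exact: integrable_pairing.
- have := integrableD measurableT ig ih.
  by apply: eq_integrable => // x _ /=; rewrite EFinD.
- by move=> x _; rewrite /= -!expr2.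
Qed.

Lemma pairing_add_le f g h : f \in L2 -> g \in L2 -> h \in L2 ->
  (forall x, f x ^+ 2 + g x ^+ 2 <= h x ^+ 2) ->
  pairing f f + pairing g g <= pairing h h.
Proof.
move=> hf hg hh H; have [ig ih] := (integrable_pairing hf hf, integrable_pairing hg hg).
rewrite /pairing -RintegralD//; apply: le_Rintegral => //.
- have := integrableD measurableT ig ih.
  by apply: eq_integrable => // x _ /=; rewrite EFinD.
- exact: integrable_pairing.
- by move=> x _; rewrite /= -!expr2.
Qed.

Lemma ae_class f : measurable_fun setT f ->
  exists u : {mfun_ mu, T >-> R}, (u : T -> R) = f %[ae mu].
Proof.
move=> mf; pose F : {mfun T >-> R} := mfun_Sub (mem_set mf).
by exists (\pi F)%qT; exact: (repr_pi_ae mu F).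
Qed.

End L2_pairing.

(** * Elements of H_0^1, and smooth functions among them *)

Section H10_elements.
Context {R : realType} (Om : set (R * R)) (oOm : open Om).
Local Notation mu := (lebesgue_on oOm).
Local Notation H := (H10space oOm).
Local Notation L2 := (Lfun mu 2%:E).
Local Notation pairing := (pairing mu).
Implicit Types (u v psi : H) (f g phi : R * R -> R) (B : set (R * R)).

(** An element is a triple of classes; the three maps give representatives of the function and of
    its two weak derivatives. *)
Definition H10fun u : plane R -> R := (H10val u).1.1.
Definition H10dx u : plane R -> R := (H10val u).1.2.
Definition H10dy u : plane R -> R := (H10val u).2.

Lemma H10P u : @H10 R Om oOm (H10val u).
Proof. by case: u => w Hw; exact/asboolP. Qed.

Lemma H10fun_L2 u : H10fun u \in L2. Proof. by have [[]] := H10P u. Qed.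
Lemma H10dx_L2 u : H10dx u \in L2. Proof. by have [[]] := H10P u. Qed.
Lemma H10dy_L2 u : H10dy u \in L2. Proof. by have [[]] := H10P u. Qed.

Lemma H10_weak1 psi phi : test_function Om phi ->
  pairing (H10fun psi) (partial1 phi) = - pairing (H10dx psi) phi.
Proof. by have [[_ _ _ h _] _] := H10P psi; exact: h. Qed.

Lemma H10_weak2 psi phi : test_function Om phi ->
  pairing (H10fun psi) (partial2 phi) = - pairing (H10dy psi) phi.
Proof. by have [[_ _ _ _ h] _] := H10P psi; exact: h. Qed.

Section supported_in_Om.
Variables (B : set (R * R)) (cB : compact B) (BOm : B `<=` Om).

Lemma smooth_L2 f : smooth f -> supported B f -> (f : plane R -> R) \in L2.
Proof.
by move=> sf f0; exact: (Lfun2_compact oOm (smooth_continuous sf) cB f0).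
Qed.

Lemma supported_partial1 f : supported B f -> supported B (partial1 f).
Proof. by move=> f0; exact: (supported_derive _ (compact_closed2 cB) f0). Qed.

Lemma supported_partial2 f : supported B f -> supported B (partial2 f).
Proof. by move=> f0; exact: (supported_derive _ (compact_closed2 cB) f0). Qed.

Lemma fine_integral_lebesgue_on f : supported B f ->
  (\int[@lebesgue2 R]_p (f p)%:E = 0)%E -> \int[mu]_p f p = 0.
Proof.
move=> f0 h; rewrite /Rintegral (@integral_lebesgue_on _ _ oOm (EFin \o (f : plane R -> R))).
  by rewrite h.
by move=> p Op /=; rewrite f0// => /BOm.
Qed.

Lemma smooth_by_parts1 f phi : smooth f -> supported B f -> test_function Om phi ->
  pairing f (partial1 phi) = - pairing (partial1 f) phi.
Proof.
move=> sf f0 tphi; have [L0 Lphi1 _] := test_function_Lfun2 oOm tphi.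
have [/(_ 1%N)[cphi dphi _ cphi1 _] _ _] := tphi.
have Lf := smooth_L2 sf f0.
have f10 := supported_partial1 f0.
have Lf1 := smooth_L2 (smooth_partial1 sf) f10.
apply/eqP; rewrite -addr_eq0; apply/eqP.
rewrite /pairing -RintegralD//; [|exact: integrable_pairing..].
apply: fine_integral_lebesgue_on.
  by move=> p Bp; rewrite f0// f10// !mul0r addr0.
apply: (@integral_partial1 _ (fun p => f p * phi p) _ B) => //.
- move=> p; have := is_deriveM (smooth_derivable1 p sf) (derivableP (dphi p)).
  by rewrite /GRing.scale/= [phi p * _]mulrC.
- move=> p; apply: cvgD; apply: cvgM.
  + exact: smooth_continuous sf p.
  + exact: cphi1.
  + exact: smooth_continuous (smooth_partial1 sf) p.
  + exact: cphi.
- by move=> p Bp; rewrite f0// mul0r.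
- by move=> p Bp; rewrite f0// f10// !mul0r addr0.
Qed.

Lemma smooth_by_parts2 f phi : smooth f -> supported B f -> test_function Om phi ->
  pairing f (partial2 phi) = - pairing (partial2 f) phi.
Proof.
move=> sf f0 tphi; have [L0 _ Lphi2] := test_function_Lfun2 oOm tphi.
have [/(_ 1%N)[cphi _ dphi _ cphi2] _ _] := tphi.
have Lf := smooth_L2 sf f0.
have f20 := supported_partial2 f0.
have Lf2 := smooth_L2 (smooth_partial2 sf) f20.
apply/eqP; rewrite -addr_eq0; apply/eqP.
rewrite /pairing -RintegralD//; [|exact: integrable_pairing..].
apply: fine_integral_lebesgue_on.
  by move=> p Bp; rewrite f0// f20// !mul0r addr0.
apply: (@integral_partial2 _ (fun p => f p * phi p) _ B) => //.
- move=> p; have := is_deriveM (smooth_derivable2 p sf) (derivableP (dphi p)).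
  by rewrite /GRing.scale/= [phi p * _]mulrC.
- move=> p; apply: cvgD; apply: cvgM.
  + exact: smooth_continuous sf p.
  + exact: cphi2.
  + exact: smooth_continuous (smooth_partial2 sf) p.
  + exact: cphi.
- by move=> p Bp; rewrite f0// mul0r.
- by move=> p Bp; rewrite f0// f20// !mul0r addr0.
Qed.

(** Since [f] is itself a test function, it serves as its own approximation, with error zero almost
    everywhere; the weak derivatives come from integration by parts. *)
Lemma smooth_H10 f : smooth f -> supported B f ->
  exists u : H, H10dx u = partial1 f %[ae mu] /\ H10dy u = partial2 f %[ae mu].
Proof.
move=> sf f0.
have tf := smooth_test_function sf cB BOm f0.
have [Lf Lf1 Lf2] := test_function_Lfun2 oOm tf.
have [v0 e0] := ae_class mu (Lfun_measurable Lf).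
have [v1 e1] := ae_class mu (Lfun_measurable Lf1).
have [v2 e2] := ae_class mu (Lfun_measurable Lf2).
have mv (v : {mfun_ mu, plane R >-> R}) : measurable_fun setT (v : plane R -> R).
  exact: measurable_funPT.
have Lv (v : {mfun_ mu, plane R >-> R}) g : (g : plane R -> R) \in Lfun mu 2%:E ->
    (v : plane R -> R) = g %[ae mu] ->
    measurable_fun setT v -> (v : plane R -> R) \in Lfun mu 2%:E.
  by move=> Lg e m; apply: (eq_ae_Lfun2 m (ae_eq_sym e) Lg).
have Lv0 := Lv _ _ Lf e0 (mv _); have Lv1 := Lv _ _ Lf1 e1 (mv _).
have Lv2 := Lv _ _ Lf2 e2 (mv _).
have N0 (v : {mfun_ mu, plane R >-> R}) (g : plane R -> R) (e : R) : 0 < e -> g \in Lfun mu 2%:E ->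
    (v : plane R -> R) = g %[ae mu] ->
    ('N[mu]_2%:E [EFin \o ((v : plane R -> R) \- g)%R] < e%:E)%E.
  move=> e_gt0 Lg vg; rewrite (@eq_ae_Lnorm2 _ _ _ mu _ (cst 0)) ?Lnorm0//.
    by apply: measurable_funB; [exact: mv|exact: Lfun_measurable Lg].
  by apply: filterS vg => p /= h _; rewrite h// subrr.
have H10v : (v0, v1, v2) \in @H10_pred R Om oOm.
  apply/asboolP; split; first split => //.
  - move=> phi tphi; have [P0 P1 P2] := test_function_Lfun2 oOm tphi.
    have := smooth_by_parts1 sf f0 tphi.
    by rewrite -(ae_pairing Lv0 Lf P1 e0) -(ae_pairing Lv1 Lf1 P0 e1).
  - move=> phi tphi; have [P0 P1 P2] := test_function_Lfun2 oOm tphi.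
    have := smooth_by_parts2 sf f0 tphi.
    by rewrite -(ae_pairing Lv0 Lf P2 e0) -(ae_pairing Lv2 Lf2 P0 e2).
  move=> e e_gt0; exists f => //; split.
  - exact: (N0 v0 _ _ e_gt0 Lf e0).
  - exact: (N0 v1 _ _ e_gt0 Lf1 e1).
  - exact: (N0 v2 _ _ e_gt0 Lf2 e2).
by exists (MkH10 H10v); split; [exact: e1|exact: e2].
Qed.

(** Both sides equal minus the pairing of [H10fun psi] with the mixed derivative of [f]: the weak
    derivatives of [psi] are tested against [partial1 f] and [partial2 f]. *)
Lemma pairing_curl psi f : smooth f -> supported B f ->
  pairing (partial1 f) (H10dy psi) = pairing (partial2 f) (H10dx psi).
Proof.
move=> sf f0.
have t1 := smooth_test_function (smooth_partial1 sf) cB BOm (supported_partial1 f0).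
have t2 := smooth_test_function (smooth_partial2 sf) cB BOm (supported_partial2 f0).
have h1 := H10_weak1 psi t2; have h2 := H10_weak2 psi t1.
rewrite (smooth_schwarz sf) in h1; have h := etrans (esym h2) h1.
rewrite (pairingC mu (partial1 f)) (pairingC mu (partial2 f)).
by move/oppr_inj: h.
Qed.

(** Continuity keeps |f| above half of |f z| on a small square around [z] inside [Om], which has
    positive measure. *)
Lemma pairing_pos f z : smooth f -> supported B f -> Om z -> f z != 0 ->
  0 < pairing f f.
Proof.
move=> sf f0 Oz fz; have cf := smooth_continuous sf; have Lf := smooth_L2 sf f0.
pose c := `|f z| / 2; have c0 : 0 < c by rewrite divr_gt0// normr_gt0.
have /nbhs_ballP[e /= e0 eO] : nbhs z (Om `&` [set p | c < `|f p|]).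
  apply: filterI; first exact: open_nbhs_nbhs.
  have cn : continuous (fun p => `|f p|).
    by move=> p; apply: continuous_comp; [exact: cf|exact: norm_continuous].
  apply: (cvgr_gt `|f z| (cn z)).
  by rewrite ltr_pdivrMr// ltr_pMr ?normr_gt0// ltr1n.
pose Q : set (plane R) := ball z.1 e `*` ball z.2 e.
have QO : Q `<=` Om by move=> p [h1 h2]; have [] := eO p (conj h1 h2).
have mQ : measurable Q by apply: measurableX; exact: measurable_ball.
have muQ : (0 < mu Q)%E.
  rewrite -[mu Q]/(lebesgue2 (Q `&` Om)) setIidl//.
  rewrite /lebesgue2 product_measure1E//=; try exact: measurable_ball.
  by rewrite !lebesgue_measure_ball ?ltW// -EFinM lte_fin mulr_gt0// mulr2n addr_gt0.
have If := integrable_pairing Lf Lf.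
rewrite /pairing /Rintegral fine_gt0//; apply/andP; split; last first.
  exact: integrable_lty.
apply: lt_le_trans (_ : \int[mu]_p ((c ^+ 2)%:E * (\1_Q p)%:E) <= _)%E.
  rewrite ge0_integralZl//; first last.
  - by rewrite lee_fin sqr_ge0.
  - exact/measurable_EFinP.
  by rewrite integral_indic// setIT mule_gt0// lte_fin exprn_gt0.
apply: ge0_le_integral => //.
- by move=> p _; rewrite -EFinM lee_fin mulr_ge0// sqr_ge0.
- by apply/measurable_EFinP; apply: measurable_funM.
- exact: measurable_int If.
- move=> p _; rewrite -EFinM lee_fin indicE -expr2.
  case: (boolP (p \in Q)) => [/set_mem[h1 h2]|_]; last by rewrite mulr0 sqr_ge0.
  have [_ /ltW h] := eO p (conj h1 h2).
  by rewrite mulr1 -[leRHS]real_normK ?num_real// lerXn2r ?nnegrE// ltW.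
Qed.

End supported_in_Om.

Definition dirichlet u v : R := pairing (H10dx u) (H10dx v) + pairing (H10dy u) (H10dy v).

Lemma int_dot_gradient u v :
  \int[mu]_p dot (gradient u p) (gradient v p) = dirichlet u v.
Proof.
rewrite /dirichlet /pairing -RintegralD//; first last.
- exact: integrable_pairing (H10dy_L2 u) (H10dy_L2 v).
- exact: integrable_pairing (H10dx_L2 u) (H10dx_L2 v).
apply: eq_Rintegral => p _.
by rewrite /dot /gradient mxE big_ord_recl big_ord1 !mxE.
Qed.

Lemma H10norm_sqr u : H10norm u ^+ 2 = dirichlet u u.
Proof.
by rewrite /H10norm int_dot_gradient sqr_sqrtr// addr_ge0// pairing_ge0.
Qed.

Lemma dirichletDl a u v psi :
  dirichlet (a *: u + v) psi = a * dirichlet u psi + dirichlet v psi.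
Proof.
have E1 := int_lin a (H10dx_L2 u) (H10dx_L2 v) (H10dx_L2 psi).
have E2 := int_lin a (H10dy_L2 u) (H10dy_L2 v) (H10dy_L2 psi).
rewrite -[LHS]/(\int[mu]_p (((a *: (H10val u).1.2 + (H10val v).1.2) :
    {mfun_ mu, plane R >-> R}) p * H10dx psi p)
  + \int[mu]_p (((a *: (H10val u).2 + (H10val v).2) :
    {mfun_ mu, plane R >-> R}) p * H10dy psi p)).
by rewrite E1 E2 mulrDr addrACA.
Qed.

Lemma dirichlet0l psi : dirichlet 0 psi = 0.
Proof. by have := dirichletDl (-1) 0 0 psi; rewrite scaler0 addr0 mulN1r addNr. Qed.

Lemma dirichletBl r u v psi :
  dirichlet (r *: u - v) psi = r * dirichlet u psi - dirichlet v psi.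
Proof.
have E := dirichletDl r u 0 psi; rewrite addr0 dirichlet0l addr0 in E.
by have := dirichletDl (-1) v (r *: u) psi; rewrite scaleN1r [- v + _]addrC E mulN1r [RHS]addrC.
Qed.

End H10_elements.

(** Covers the functionals outside the range of [L], on which the formal inverse of [L] takes its
    default value, chosen to be 0 below. *)
Lemma pinv_default {T U : Type} (dflt : U -> T) (A : set T) (f : T -> U) y :
  ~ (f @` A) y -> 'pinv_dflt A f y = dflt y.
Proof.
move=> yA; rewrite /pinv_ splitV.
rewrite (_ : 'oinv_[fun f in A] y = None)//.
have := @oinv_surj T U A (f @` A) f (fun _ => id) y.
by case: pselect.
Qed.

Lemma Hm1space_ext {R : realType} (Om : set (R * R)) (oOm : open Om)
  (F G : Hm1space oOm) : (forall u, F u = G u) -> F = G.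
Proof.
case: F G => [F F1 F2] [G G1 G2] /= FG; have E : F = G by apply/funext.
by subst G; congr MkHm1; exact: Prop_irrelevance.
Qed.

(** * Action of [L], [A] and the solution operator on functions supported in [S] *)

Section solution_operator.
(* Otherwise comparing two distinct iterated derivatives unfolds them down to limits. *)
Local Opaque partial1 partial2.
Context {R : realType} (Om : set (R * R)) (oOm : open Om).
Context (k1 k2 : R * R -> R) (S : set (R * R)) (SOm : S `<=` Om) (c1 c2 : R).
Hypothesis ck1 : forall p, S p -> k1 p = c1.
Hypothesis ck2 : forall p, S p -> k2 p = c2.
Context (L A : H10space oOm -> Hm1space oOm).
Hypothesis LE : forall phi psi, L phi psi =
  \int[lebesgue_on oOm]_p dot (gradient phi p) (gradient psi p).
Hypothesis AE : forall phi psi, A phi psi =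
  \int[lebesgue_on oOm]_p
    dot (diagonal_tensor k1 k2 p *m gradient phi p) (gradient psi p).

Local Notation mu := (lebesgue_on oOm).
Local Notation pairing := (pairing mu).
Local Notation H := (H10space oOm).
Local Notation T := ('pinv_(fun=> 0) setT L \o A).
Implicit Types (u v psi : H) (f g : R * R -> R) (B : set (R * R)).

(** Only gradients are compared, since the forms of [L] and [A] see nothing else of [u]. *)
Definition represents u f :=
  H10dx u = partial1 f %[ae mu] /\ H10dy u = partial2 f %[ae mu].

Lemma L_dirichlet u psi : L u psi = dirichlet u psi.
Proof. by rewrite LE int_dot_gradient. Qed.

Section locally_supported.
Variables (B : set (R * R)) (cB : compact B) (BS : B `<=` S).
Let BOm : B `<=` Om := subset_trans BS SOm.

Lemma L_smooth f u psi : smooth f -> supported B f -> represents u f ->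
  L u psi = pairing (partial1 f) (H10dx psi) + pairing (partial2 f) (H10dy psi).
Proof.
move=> sf f0 [u1 u2]; rewrite L_dirichlet /dirichlet.
have [_ Lf1 Lf2] := test_function_Lfun2 oOm (smooth_test_function sf cB BOm f0).
by rewrite (ae_pairing (H10dx_L2 u) Lf1 (H10dx_L2 psi) u1)
           (ae_pairing (H10dy_L2 u) Lf2 (H10dy_L2 psi) u2).
Qed.

(** The coefficients are the constants [c1] and [c2] on [B], and the gradient of [f] vanishes
    outside [B], so the integrand agrees almost everywhere with one of constant coefficients. *)
Lemma A_smooth f u psi : smooth f -> supported B f -> represents u f ->
  A u psi = c1 * pairing (partial1 f) (H10dx psi) + c2 * pairing (partial2 f) (H10dy psi).
Proof.
move=> sf f0 [u1 u2].
have [_ Lf1 Lf2] := test_function_Lfun2 oOm (smooth_test_function sf cB BOm f0).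
rewrite AE.
transitivity (\int[mu]_p (c1 * (partial1 f p * H10dx psi p) + c2 * (partial2 f p * H10dy psi p))).
  rewrite /Rintegral; congr fine; apply: ae_eq_integral_nonmeasurable.
  apply: filterS2 u1 u2 => p e1 e2 _; congr EFin.
  have -> : dot (diagonal_tensor k1 k2 p *m gradient u p) (gradient psi p) =
      k1 p * H10dx u p * H10dx psi p + k2 p * H10dy u p * H10dy psi p.
    rewrite /dot /diagonal_tensor /gradient mxE big_ord_recl big_ord1 !mxE.
    rewrite !big_ord_recl !big_ord0 !mxE /=.
    by rewrite !mulr1n !mulr0n !mul0r !addr0 !add0r.
  rewrite e1// e2// -!mulrA.
  have [Bp|nB] := pselect (B p); first by rewrite ck1 ?ck2//; exact: BS.
  by rewrite (supported_partial1 cB f0 nB) (supported_partial2 cB f0 nB) !mul0r !mulr0.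
have i1 := integrable_pairing Lf1 (H10dx_L2 psi).
have i2 := integrable_pairing Lf2 (H10dy_L2 psi).
rewrite /Defs.lebesgue_on RintegralD//; first by rewrite !RintegralZl.
- have := integrableZl measurableT c1 i1.
  by apply: eq_integrable => // x _ /=; rewrite EFinM.
- have := integrableZl measurableT c2 i2.
  by apply: eq_integrable => // x _ /=; rewrite EFinM.
Qed.

(** Coefficients (1, 1) give the Laplacian, and (c1, c2) the operator div (K grad) as it acts on
    [S]. *)
Definition D2 c c' f : R * R -> R :=
  fun p => c * partial1 (partial1 f) p + c' * partial2 (partial2 f) p.

Lemma smooth_D2 c c' f : smooth f -> smooth (D2 c c' f).
Proof.
by move=> sf; apply: smoothD; apply: smooth_scale;
  [exact/smooth_partial1/smooth_partial1|exact/smooth_partial2/smooth_partial2].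
Qed.

Lemma supported_D2 c c' f : supported B f -> supported B (D2 c c' f).
Proof.
move=> f0 p nB.
have z1 := supported_partial1 cB (supported_partial1 cB f0) nB.
have z2 := supported_partial2 cB (supported_partial2 cB f0) nB.
by rewrite /D2 z1 z2 !mulr0 addr0.
Qed.

Lemma pairing_D2 c c' f psi : smooth f -> supported B f ->
  pairing (H10fun psi) (D2 c c' f) =
  - (c * pairing (partial1 f) (H10dx psi) + c' * pairing (partial2 f) (H10dy psi)).
Proof.
move=> sf f0.
have [sf1 sf2] := (smooth_partial1 sf, smooth_partial2 sf).
have [f10 f20] := (supported_partial1 cB f0, supported_partial2 cB f0).
have t1 := smooth_test_function sf1 cB BOm f10.
have t2 := smooth_test_function sf2 cB BOm f20.
have L11 := smooth_L2 oOm cB (smooth_partial1 sf1) (supported_partial1 cB f10).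
have L22 := smooth_L2 oOm cB (smooth_partial2 sf2) (supported_partial2 cB f20).
have e1 : pairing (partial1 (partial1 f)) (H10fun psi) = - pairing (partial1 f) (H10dx psi).
  exact: etrans (pairingC _ _ _) (etrans (H10_weak1 psi t1) (congr1 -%R (pairingC _ _ _))).
have e2 : pairing (partial2 (partial2 f)) (H10fun psi) = - pairing (partial2 f) (H10dy psi).
  exact: etrans (pairingC _ _ _) (etrans (H10_weak2 psi t2) (congr1 -%R (pairingC _ _ _))).
apply: etrans (pairingC _ _ _) (etrans (pairing_linl c c' L11 L22 (H10fun_L2 psi)) _).
by apply: etrans (congr2 (fun x y => c * x + c' * y) e1 e2) _; rewrite !mulrN -opprD.
Qed.

Lemma partial11_D2 c c' f : smooth f -> partial1 (partial1 (D2 c c' f)) =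
  (fun p => c * partial1 (partial1 (partial1 (partial1 f))) p
          + c' * partial1 (partial1 (partial2 (partial2 f))) p).
Proof.
move=> sf; have sf11 := smooth_partial1 (smooth_partial1 sf).
have sf22 := smooth_partial2 (smooth_partial2 sf).
rewrite /D2 (partial1_lin c c' sf11 sf22).
exact: partial1_lin (smooth_partial1 sf11) (smooth_partial1 sf22).
Qed.

Lemma partial22_D2 c c' f : smooth f -> partial2 (partial2 (D2 c c' f)) =
  (fun p => c * partial2 (partial2 (partial1 (partial1 f))) p
          + c' * partial2 (partial2 (partial2 (partial2 f))) p).
Proof.
move=> sf; have sf11 := smooth_partial1 (smooth_partial1 sf).
have sf22 := smooth_partial2 (smooth_partial2 sf).
rewrite /D2 (partial2_lin c c' sf11 sf22).
exact: partial2_lin (smooth_partial2 sf11) (smooth_partial2 sf22).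
Qed.

(** Constant-coefficient operators commute; the only terms to exchange are the mixed fourth
    derivatives. *)
Lemma D2_comm a b c c' f : smooth f -> D2 a b (D2 c c' f) = D2 c c' (D2 a b f).
Proof.
move=> sf; apply/funext => p.
apply: etrans (congr2 (fun x y : R * R -> R => a * x p + b * y p)
  (partial11_D2 c c' sf) (partial22_D2 c c' sf)) _.
apply: etrans _ (esym (congr2 (fun x y : R * R -> R => c * x p + c' * y p)
  (partial11_D2 a b sf) (partial22_D2 a b sf))).
have E x y y' z : y = y' -> a * (c * x + c' * y) + b * (c * y' + c' * z) =
    c * (a * x + b * y) + c' * (a * y' + b * z) by move=> ->; ring.
exact: E (congr1 (@^~ p) (smooth_schwarz4 sf)).
Qed.

(** Integration by parts turns [A u psi] and [L v psi] into minus the integrals of [psi] against the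
    Laplacian and c1 d_xx + c2 d_yy composed in the two orders and applied to [f]; these operators
    commute. *)
Lemma A_in_range f : smooth f -> supported B f ->
  exists u v, [/\ represents u (D2 1 1 f), represents v (D2 c1 c2 f) & A u = L v].
Proof.
move=> sf f0.
have [su sv] := (smooth_D2 1 1 sf, smooth_D2 c1 c2 sf).
have [u0 v0] := (supported_D2 1 1 f0, supported_D2 c1 c2 f0).
have [u ru] := smooth_H10 oOm cB BOm su u0.
have [v rv] := smooth_H10 oOm cB BOm sv v0.
exists u, v; split=> //; apply: Hm1space_ext => psi.
rewrite (A_smooth psi su u0 ru) (L_smooth psi sv v0 rv).
have := pairing_D2 1 1 psi sv v0; rewrite (D2_comm _ _ _ _ sf) (pairing_D2 c1 c2 psi su u0).
by move/oppr_inj; rewrite !mul1r.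
Qed.

Lemma dirichlet_smooth f v : smooth f -> supported B f -> represents v f ->
  dirichlet v v = pairing (partial1 f) (partial1 f) + pairing (partial2 f) (partial2 f).
Proof.
move=> sf f0 rv; rewrite -L_dirichlet (L_smooth v sf f0 rv).
have [_ Lf1 Lf2] := test_function_Lfun2 oOm (smooth_test_function sf cB BOm f0).
case: rv => v1 v2.
have e1 := ae_pairing (H10dx_L2 v) Lf1 Lf1 v1; have e2 := ae_pairing (H10dy_L2 v) Lf2 Lf2 v2.
apply: congr2; first exact: etrans (pairingC _ _ _) e1.
exact: etrans (pairingC _ _ _) e2.
Qed.

Lemma dirichlet_gt0 f v z : smooth f -> supported B f -> represents v f -> S z ->
  partial1 f z != 0 \/ partial2 f z != 0 -> 0 < dirichlet v v.
Proof.
move=> sf f0 rv /SOm Oz fz; rewrite (dirichlet_smooth sf f0 rv).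
case: fz => fz.
  apply: ltr_wpDr; first exact: pairing_ge0.
  exact: (pairing_pos oOm cB (smooth_partial1 sf) (supported_partial1 cB f0) Oz fz).
apply: ltr_wpDl; first exact: pairing_ge0.
exact: (pairing_pos oOm cB (smooth_partial2 sf) (supported_partial2 cB f0) Oz fz).
Qed.

End locally_supported.

(** At [z] a term survives only if three x-derivatives fall on the cube, which yields 3! = 6; the
    y-derivatives leave the cube untouched, and one x-derivative does not remove its zero. *)
Lemma partial1_D2_cube c c' f z : smooth f ->
  partial1 (D2 c c' (fun p => (p.1 - z.1) ^+ 3 * f p)) z = 6 * c * f z.
Proof.
move=> sf; pose g (p : R * R) := (p.1 - z.1) ^+ 3 * f p.
rewrite -[LHS]/(partial1 (fun p => c * partial1 (partial1 g) p + c' * partial2 (partial2 g) p) z).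
have X n h : smooth h -> smooth (fun p : R * R => (p.1 - z.1) ^+ n * h p).
  by move=> sh; exact: smoothM (smooth_expr1 _ n) sh.
have sf2 := smooth_partial2 sf; have sf22 := smooth_partial2 sf2.
have [sf1 sf11] := (smooth_partial1 sf, smooth_partial1 (smooth_partial1 sf)).
have sg : smooth g by exact: X.
rewrite (partial1_lin c c' (smooth_partial1 (smooth_partial1 sg))
  (smooth_partial2 (smooth_partial2 sg))).
have -> : partial2 (partial2 g) = (fun p => (p.1 - z.1) ^+ 3 * partial2 (partial2 f) p).
  by rewrite /g (partial2_expr1M _ 3 sf) (partial2_expr1M _ 3 sf2).
rewrite (partial1_expr1M z.1 3 sf22) /g (partial1_expr1M z.1 3 sf).
rewrite (partial1_lin 3 1 (X 2%N _ sf) (X 3%N _ sf1)).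
rewrite (partial1_expr1M z.1 2 sf) (partial1_expr1M z.1 3 sf1).
have s1 := smoothD (smooth_scale 2 (X 1%N _ sf)) (smooth_scale 1 (X 2%N _ sf1)).
have s2 := smoothD (smooth_scale 3 (X 2%N _ sf1)) (smooth_scale 1 (X 3%N _ sf11)).
rewrite (partial1_lin 3 1 s1 s2).
rewrite (partial1_lin 2 1 (X 1%N _ sf) (X 2%N _ sf1)).
rewrite (partial1_lin 3 1 (X 2%N _ sf1) (X 3%N _ sf11)).
rewrite (partial1_expr1M z.1 1 sf) (partial1_expr1M z.1 2 sf1) (partial1_expr1M z.1 3 sf11).
cbv beta; rewrite subrr.
generalize (f z) (partial1 f z) (partial1 (partial1 f) z) (partial1 (partial1 (partial1 f)) z)
  (partial2 (partial2 f) z) (partial1 (partial2 (partial2 f)) z) => a0 a1 a2 a3 a4 a5.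
by rewrite /= !expr0n /=; ring.
Qed.

Lemma partial2_D2_cube c c' f z : smooth f ->
  partial2 (D2 c c' (fun p => (p.2 - z.2) ^+ 3 * f p)) z = 6 * c' * f z.
Proof.
move=> sf; pose g (p : R * R) := (p.2 - z.2) ^+ 3 * f p.
rewrite -[LHS]/(partial2 (fun p => c * partial1 (partial1 g) p + c' * partial2 (partial2 g) p) z).
have X n h : smooth h -> smooth (fun p : R * R => (p.2 - z.2) ^+ n * h p).
  by move=> sh; exact: smoothM (smooth_expr2 _ n) sh.
have sf1 := smooth_partial1 sf; have sf11 := smooth_partial1 sf1.
have [sf2 sf22] := (smooth_partial2 sf, smooth_partial2 (smooth_partial2 sf)).
have sg : smooth g by exact: X.
rewrite (partial2_lin c c' (smooth_partial1 (smooth_partial1 sg))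
  (smooth_partial2 (smooth_partial2 sg))).
have -> : partial1 (partial1 g) = (fun p => (p.2 - z.2) ^+ 3 * partial1 (partial1 f) p).
  by rewrite /g (partial1_expr2M _ 3 sf) (partial1_expr2M _ 3 sf1).
rewrite (partial2_expr2M z.2 3 sf11) /g (partial2_expr2M z.2 3 sf).
rewrite (partial2_lin 3 1 (X 2%N _ sf) (X 3%N _ sf2)).
rewrite (partial2_expr2M z.2 2 sf) (partial2_expr2M z.2 3 sf2).
have s1 := smoothD (smooth_scale 2 (X 1%N _ sf)) (smooth_scale 1 (X 2%N _ sf2)).
have s2 := smoothD (smooth_scale 3 (X 2%N _ sf2)) (smooth_scale 1 (X 3%N _ sf22)).
rewrite (partial2_lin 3 1 s1 s2).
rewrite (partial2_lin 2 1 (X 1%N _ sf) (X 2%N _ sf2)).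
rewrite (partial2_lin 3 1 (X 2%N _ sf2) (X 3%N _ sf22)).
rewrite (partial2_expr2M z.2 1 sf) (partial2_expr2M z.2 2 sf2) (partial2_expr2M z.2 3 sf22).
cbv beta; rewrite subrr.
generalize (f z) (partial2 f z) (partial2 (partial2 f) z) (partial2 (partial2 (partial2 f)) z)
  (partial1 (partial1 f) z) (partial2 (partial1 (partial1 f)) z) => a0 a1 a2 a3 a4 a5.
by rewrite /= !expr0n /=; ring.
Qed.

Lemma A_sym u psi : A u psi = A psi u.
Proof.
rewrite !AE; apply: eq_Rintegral => p _; rewrite /dot /diagonal_tensor !mxE.
by rewrite !big_ord_recl !big_ord0 !mul_diag_mx !mxE; ring.
Qed.

(* By symmetry, additivity in the first argument follows from the linearity of
[A psi] as an element of H^-1, whatever the regularity of k1 and k2. *)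
Lemma AD u v psi : A (u + v) psi = A u psi + A v psi.
Proof.
rewrite A_sym (A_sym u) (A_sym v); case: (A psi) => F /= FL _.
by have := FL 1 u v; rewrite scale1r mul1r.
Qed.

Lemma L_T u : (exists v, A u = L v) -> L (T u) = A u.
Proof.
move=> [v Av]; rewrite /= pinvK//.
by apply/mem_set; exists v.
Qed.

Lemma T_eq0 u : ~ (exists v, A u = L v) -> T u = 0.
Proof.
by move=> h; rewrite /= pinv_default// => -[v _ e]; apply: h; exists v.
Qed.

(** The Laplacian [u] of a suitable function satisfies A u = L v with v of positive energy, whereas
    T u = 0 would give L v = 0. *)
Lemma T_neq0 : open S -> S !=set0 -> c1 != c2 ->
  exists u, (exists v, A u = L v) /\ T u <> 0.
Proof.
move=> oS [z Sz] c12.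
have [B [chi [cB BS schi chi0 chiz]]] := smooth_bump oS Sz.
have [f [sf f0 fz]] : exists f, [/\ smooth f, supported B f &
    partial1 (D2 c1 c2 f) z != 0 \/ partial2 (D2 c1 c2 f) z != 0].
  (* As [c1] and [c2] differ, one of them is nonzero; the cube is taken in the corresponding
     variable, so that the third derivative at [z] is nonzero. *)
  have [c10|c10] := eqVneq c1 0.
    have c20 : c2 != 0 by rewrite -c10 eq_sym.
    exists (fun p => (p.2 - z.2) ^+ 3 * chi p); split.
    - exact: smoothM (smooth_expr2 _ 3) schi.
    - by move=> p /chi0 ->; rewrite mulr0.
    - right; rewrite partial2_D2_cube// !mulf_neq0 ?pnatr_eq0//.
      by rewrite gt_eqF.
  exists (fun p => (p.1 - z.1) ^+ 3 * chi p); split.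
  - exact: smoothM (smooth_expr1 _ 3) schi.
  - by move=> p /chi0 ->; rewrite mulr0.
  - left; rewrite partial1_D2_cube// !mulf_neq0 ?pnatr_eq0//.
    by rewrite gt_eqF.
have [u [v [ru rv Auv]]] := A_in_range cB BS sf f0.
exists u; split; first by exists v.
move=> Tu0; have LTu : L (T u) = L v by rewrite L_T//; exists v.
have v0 : 0 < dirichlet v v.
  exact: (dirichlet_gt0 cB BS (smooth_D2 c1 c2 sf) (supported_D2 cB c1 c2 f0) rv Sz fz).
by move: v0; rewrite -L_dirichlet -LTu Tu0 L_dirichlet dirichlet0l ltxx.
Qed.

(** If [A u] were outside the range, so would [A (u + w)] be, because [A w] is in it; [T] would
    vanish at both, and additivity would give T w = 0. *)
Lemma range_total : open S -> S !=set0 -> c1 != c2 ->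
  (forall u v, T (u + v) = T u + T v) -> forall u, L (T u) = A u.
Proof.
move=> oS S0 c12 TD u; have [w [[w' Aw] Tw]] := T_neq0 oS S0 c12.
have [Ru|Ru] := pselect (exists v, A u = L v); first exact: L_T.
exfalso; apply: Tw.
have Ruw : ~ exists v, A (u + w) = L v.
  (* A u = A (u + w) - A w would be the image of v - w'. *)
  move=> [v Av]; apply: Ru; exists (-1 *: w' + v); apply: Hm1space_ext => psi.
  rewrite L_dirichlet dirichletDl -!L_dirichlet -Av -Aw AD; ring.
by have := TD u w; rewrite (T_eq0 Ru) (T_eq0 Ruw) add0r => <-.
Qed.


(* The antisymmetric part [[0, c], [-c, 0]] contributes nothing by [pairing_curl]. *)
Lemma residual_le r c B f u : compact B -> B `<=` S ->
  smooth f -> supported B f -> represents u f -> L (T u) = A u ->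
  dirichlet (r *: u - T u) (r *: u - T u) <=
  pairing (fun p => (r - c1) * partial1 f p + c * partial2 f p)
          (fun p => (r - c1) * partial1 f p + c * partial2 f p) +
  pairing (fun p => - c * partial1 f p + (r - c2) * partial2 f p)
          (fun p => - c * partial1 f p + (r - c2) * partial2 f p).
Proof.
move=> cB BS sf f0 ru LTu; set e := r *: u - T u.
have BOm := subset_trans BS SOm.
have [_ Lf1 Lf2] := test_function_Lfun2 oOm (smooth_test_function sf cB BOm f0).
have LV1 := Lfun2_lin (r - c1) c Lf1 Lf2; have LV2 := Lfun2_lin (- c) (r - c2) Lf1 Lf2.
have E1 := pairing_linl (r - c1) c Lf1 Lf2 (H10dx_L2 e).
have E2 := pairing_linl (- c) (r - c2) Lf1 Lf2 (H10dy_L2 e).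
(* Testing with the residual [e] itself puts its own energy on the right as well, to be absorbed on
   the left. *)
have M1 := pairing_AMGM LV1 (H10dx_L2 e); have M2 := pairing_AMGM LV2 (H10dy_L2 e).
have C := pairing_curl cB BOm e sf f0.
have De : dirichlet e e = r * L u e - A u e.
  by rewrite {1}/e dirichletBl -!L_dirichlet LTu.
have Lu := L_smooth cB BS e sf f0 ru; have Au := A_smooth cB BS e sf f0 ru.
(* Pure algebra: the [c] terms cancel as p12 = p21, so that g = w1 + w2 and 2 g <= v1 + v2 + g. *)
have K (v1 v2 w1 w2 p11 p12 p21 p22 g1 g2 g l a : R) :
    w1 = (r - c1) * p11 + c * p21 -> w2 = - c * p12 + (r - c2) * p22 ->
    2 * w1 <= v1 + g1 -> 2 * w2 <= v2 + g2 -> p12 = p21 ->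
    g = r * l - a -> l = p11 + p22 -> a = c1 * p11 + c2 * p22 -> g = g1 + g2 ->
    g <= v1 + v2.
  move=> ew1 ew2 h1 h2 e12 eg el ea eg'.
  have : g = w1 + w2 by rewrite eg el ea ew1 ew2 e12; ring.
  move=> eg2; have := lerD h1 h2.
  by rewrite -mulrDr -eg2 addrACA -eg' mulr_natl mulr2n lerD2r.
exact: K E1 E2 M1 M2 C De Lu Au erefl.
Qed.

End solution_operator.

(** At a real parameter the two components of the complexification decouple. Linearity of the
    inverse makes r - T additive, and its bound, read on the vector u + i v, is an energy estimate
    for the pair. *)
Lemma not_spectrum {R : realType} (V : lmodType R) (N Q : V -> R) (T : V -> V) (r : R) :
  (forall u, N u ^+ 2 = Q u) -> ~ spectrum N T (r%:C)%C ->
  (forall u v, T (u + v) = T u + T v) /\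
  exists2 D, 0 <= D & forall u v, Q u + Q v <=
    D * (Q (r *: u - T u) + Q (r *: v - T v)).
Proof.
move=> NQ /contrapT [B [[C HC] FK BK]]; split.
  move=> u v.
  pose F (w : complexification V) := (r%:C)%C *: w - cmap T w.
  (* [F] is additive as the two-sided inverse of the additive map [B]. *)
  have FD w w' : F (w + w') = F w + F w'.
    by rewrite -[RHS]BK raddfD /= !FK.
  have := congr1 fst (FD (u, 0) (v, 0)).
  rewrite -[LHS]/(r *: (u + v) - 0 *: (0 + 0) - T (u + v)).
  rewrite -[RHS]/(r *: u - 0 *: 0 - T u + (r *: v - 0 *: 0 - T v)).
  rewrite !scale0r !subr0 [RHS]addrACA -scalerDr -opprD.
  by move=> /addrI /oppr_inj.
(* Squaring the bound yields a nonnegative constant, whatever the sign of [C]. *)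
exists (C ^+ 2) => [|u v]; first exact: sqr_ge0.
have := HC ((r%:C)%C *: ((u, v) : complexification V) - cmap T (u, v)).
rewrite FK.
have -> : (r%:C)%C *: ((u, v) : complexification V) - cmap T (u, v) =
    ((r *: u - T u, r *: v - T v) : complexification V).
  rewrite -[LHS]/(r *: u - 0 *: v - T u, r *: v + 0 *: u - T v).
  by rewrite !scale0r subr0 addr0.
rewrite /cnorm /= !NQ; set x := _ + _; set y := _ + _ => h.
have x0 : 0 <= x by rewrite addr_ge0// -NQ sqr_ge0.
have y0 : 0 <= y by rewrite addr_ge0// -NQ sqr_ge0.
rewrite -(sqr_sqrtr x0) -(sqr_sqrtr y0) -exprMn lerXn2r ?nnegrE ?sqrtr_ge0//.
by apply: le_trans h; exact: sqrtr_ge0.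
Qed.

(** For c^2 = - m1 m2 the matrix [[m1, c], [-c, m2]] has determinant zero. Its kernel contains (c,
    -m1), which is nonzero unless m1 = 0; in that case (m2, c) serves, with m2 nonzero. *)
Lemma singular_kernel {R : rcfType} (m1 m2 : R) : m1 * m2 <= 0 -> m1 != m2 ->
  exists c p1 p2, [/\ m1 * p1 + c * p2 = 0, - c * p1 + m2 * p2 = 0 & 0 < p1 ^+ 2 + p2 ^+ 2].
Proof.
move=> m12 m1m2; pose c := Num.sqrt (- (m1 * m2)); exists c.
have c2 : c * c = - (m1 * m2) by rewrite -expr2 sqr_sqrtr// oppr_ge0.
have [m10|m10] := eqVneq m1 0.
  exists m2, c; split; [rewrite c2; ring|ring|].
  apply: ltr_pwDl; last exact: sqr_ge0.
  by rewrite lt_neqAle sqr_ge0 eq_sym sqrf_eq0 -m10 eq_sym m1m2.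
exists c, (- m1); split; [ring|rewrite mulNr c2; ring|].
apply: ltr_wpDl; first exact: sqr_ge0.
by rewrite lt_neqAle sqr_ge0 eq_sym sqrf_eq0 oppr_eq0 m10.
Qed.

(** * Oscillating waves with amplitude [chi] *)

Section oscillation.
Context {R : realType}.
Variables (a b : R) (chi : R * R -> R) (schi : smooth chi).

(** The vector (a, b) is the frequency; the trailing [+ 0] matches the general form of a ridge. *)
Definition sin_wave p := chi p * sin (a * p.1 + b * p.2 + 0).
Definition cos_wave p := chi p * cos (a * p.1 + b * p.2 + 0).

Lemma smooth_sin_wave : smooth sin_wave.
Proof. exact: smoothM schi (smooth_sin a b 0). Qed.

Lemma smooth_cos_wave : smooth cos_wave.
Proof. exact: smoothM schi (smooth_cos a b 0). Qed.

Lemma partial_sin_wave p (t := a * p.1 + b * p.2 + 0) :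
  partial1 sin_wave p = partial1 chi p * sin t + a * chi p * cos t /\
  partial2 sin_wave p = partial2 chi p * sin t + b * chi p * cos t.
Proof.
have s := smooth_sin a b 0.
have E1 := partial1_ridge a b 0 (@is_derive_sin R).
have E2 := partial2_ridge a b 0 (@is_derive_sin R).
split; first apply: etrans (congr1 (@^~ p) (partial1M schi s)) _.
  by rewrite E1 mulrCA mulrA.
apply: etrans (congr1 (@^~ p) (partial2M schi s)) _.
by rewrite E2 mulrCA mulrA.
Qed.

Lemma partial_cos_wave p (t := a * p.1 + b * p.2 + 0) :
  partial1 cos_wave p = partial1 chi p * cos t - a * chi p * sin t /\
  partial2 cos_wave p = partial2 chi p * cos t - b * chi p * sin t.
Proof.
have s := smooth_cos a b 0.
have E1 := partial1_ridge a b 0 (@is_derive_cos R).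
have E2 := partial2_ridge a b 0 (@is_derive_cos R).
split; first apply: etrans (congr1 (@^~ p) (partial1M schi s)) _.
  by rewrite E1 mulrCA !mulrN mulrA.
apply: etrans (congr1 (@^~ p) (partial2M schi s)) _.
by rewrite E2 mulrCA !mulrN mulrA.
Qed.

(** Adding the squares for the sine and cosine waves removes the phase, leaving the squares of chi_x
    and of a chi; this is why the two waves are used together. *)
Lemma sqr_partial1_wave p :
  (a * chi p) ^+ 2 <= partial1 sin_wave p ^+ 2 + partial1 cos_wave p ^+ 2.
Proof.
rewrite (partial_sin_wave p).1 (partial_cos_wave p).1.
have := cos2Dsin2 (a * p.1 + b * p.2 + 0).
move: (cos _) (sin _) (partial1 chi p) (a * chi p) => x y z w h.
have -> : (z * y + w * x) ^+ 2 + (z * x - w * y) ^+ 2 = (z ^+ 2 + w ^+ 2) * (x ^+ 2 + y ^+ 2).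
  by ring.
by rewrite h mulr1 lerDr sqr_ge0.
Qed.

Lemma sqr_partial2_wave p :
  (b * chi p) ^+ 2 <= partial2 sin_wave p ^+ 2 + partial2 cos_wave p ^+ 2.
Proof.
rewrite (partial_sin_wave p).2 (partial_cos_wave p).2.
have := cos2Dsin2 (a * p.1 + b * p.2 + 0).
move: (cos _) (sin _) (partial2 chi p) (b * chi p) => x y z w h.
have -> : (z * y + w * x) ^+ 2 + (z * x - w * y) ^+ 2 = (z ^+ 2 + w ^+ 2) * (x ^+ 2 + y ^+ 2).
  by ring.
by rewrite h mulr1 lerDr sqr_ge0.
Qed.

(** For (a, b) orthogonal to (s, t) the derivatives of the phase cancel and only [chi] is
    differentiated: the bound does not depend on the size of the frequency. *)
Lemma sqr_kernel_wave s t p : s * a + t * b = 0 ->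
  (s * partial1 sin_wave p + t * partial2 sin_wave p) ^+ 2 +
  (s * partial1 cos_wave p + t * partial2 cos_wave p) ^+ 2 <=
  (s * partial1 chi p + t * partial2 chi p) ^+ 2.
Proof.
move=> st; have [-> ->] := partial_sin_wave p; have [-> ->] := partial_cos_wave p.
have := cos2Dsin2 (a * p.1 + b * p.2 + 0).
move: (cos _) (sin _) (partial1 chi p) (partial2 chi p) (chi p) => x y z w u h.
have -> : s * (z * y + a * u * x) + t * (w * y + b * u * x) = (s * z + t * w) * y.
  by rewrite -[RHS]addr0 -[in RHS](mul0r (u * x)) -st; ring.
have -> : s * (z * x - a * u * y) + t * (w * x - b * u * y) = (s * z + t * w) * x.
  by rewrite -[RHS]subr0 -[in RHS](mul0r (u * y)) -st; ring.
by rewrite !exprMn -mulrDr [y ^+ 2 + _]addrC h mulr1.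
Qed.

End oscillation.

(** * Unboundedness of the inverse by high-frequency waves *)

Section interior_spectrum.
Context {R : realType} (Om : set (R * R)) (oOm : open Om).
Context (k1 k2 : R * R -> R) (S : set (R * R)) (SOm : S `<=` Om) (c1 c2 : R).
Hypothesis ck1 : forall p, S p -> k1 p = c1.
Hypothesis ck2 : forall p, S p -> k2 p = c2.
Context (L A : H10space oOm -> Hm1space oOm).
Hypothesis LE : forall phi psi, L phi psi =
  \int[lebesgue_on oOm]_p dot (gradient phi p) (gradient psi p).
Hypothesis AE : forall phi psi, A phi psi =
  \int[lebesgue_on oOm]_p
    dot (diagonal_tensor k1 k2 p *m gradient phi p) (gradient psi p).
Local Notation mu := (lebesgue_on oOm).
Local Notation pairing := (pairing mu).
Local Notation T := ('pinv_(fun=> 0) setT L \o A).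

Lemma hyperbolic_in_spectrum r : open S -> S !=set0 -> c1 != c2 ->
  (r - c1) * (r - c2) <= 0 -> spectrum (@H10norm R Om oOm) T (r%:C)%C.
Proof.
move=> oS S0 c12 rc; apply: contrapT => /(not_spectrum (@H10norm_sqr R Om oOm)) [TD [D D0 HD]].
have LT := range_total SOm ck1 ck2 LE AE oS S0 c12 TD.
have m12 : r - c1 != r - c2 by apply: contra c12 => /eqP/addrI/oppr_inj->.
have [c [p1 [p2 [ker1 ker2 pp]]]] := singular_kernel rc m12.
case: S0 => z Sz; have [B [chi [cB BS schi chi0 chiz]]] := smooth_bump oS Sz.
have BOm := subset_trans BS SOm.
have Lchi := smooth_L2 oOm cB schi chi0.
have Lc1 := smooth_L2 oOm cB (smooth_partial1 schi) (supported_partial1 cB chi0).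
have Lc2 := smooth_L2 oOm cB (smooth_partial2 schi) (supported_partial2 cB chi0).
pose P := pairing chi chi.
have P0 : 0 < P by apply: (pairing_pos oOm cB schi chi0 (SOm Sz)); rewrite gt_eqF.
(* The two components of N grad chi, with N the singular matrix. *)
pose W1 p := (r - c1) * partial1 chi p + c * partial2 chi p.
pose W2 p := - c * partial1 chi p + (r - c2) * partial2 chi p.
have LW1 : (W1 : plane R -> R) \in Lfun mu 2%:E := Lfun2_lin _ _ Lc1 Lc2.
have LW2 : (W2 : plane R -> R) \in Lfun mu 2%:E := Lfun2_lin _ _ Lc1 Lc2.
pose K := pairing W1 W1 + pairing W2 W2.
have key (n : nat) : n%:R ^+ 2 * (p1 ^+ 2 + p2 ^+ 2) * P <= D * K.
  pose a := n%:R * p1; pose b := n%:R * p2.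
  pose f := sin_wave a b chi; pose g := cos_wave a b chi.
  have [sf sg] := (smooth_sin_wave a b schi, smooth_cos_wave a b schi).
  have f0 : supported B f by exact: supportedMl.
  have g0 : supported B g by exact: supportedMl.
  have [u ru] := smooth_H10 oOm cB BOm sf f0.
  have [v rv] := smooth_H10 oOm cB BOm sg g0.
  have [_ Lf1 Lf2] := test_function_Lfun2 oOm (smooth_test_function sf cB BOm f0).
  have [_ Lg1 Lg2] := test_function_Lfun2 oOm (smooth_test_function sg cB BOm g0).
  have Ru := residual_le SOm ck1 ck2 LE AE r c cB BS sf f0 ru (LT u).
  have Rv := residual_le SOm ck1 ck2 LE AE r c cB BS sg g0 rv (LT v).
  have k1ab : (r - c1) * a + c * b = 0.
    by rewrite /a /b !(mulrCA _ n%:R) -mulrDr ker1 mulr0.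
  have k2ab : - c * a + (r - c2) * b = 0.
    by rewrite /a /b !(mulrCA _ n%:R) -mulrDr ker2 mulr0.
  have U1 := pairing_add_le (Lfun2_lin (r - c1) c Lf1 Lf2) (Lfun2_lin (r - c1) c Lg1 Lg2) LW1
    (fun p => sqr_kernel_wave schi p k1ab).
  have U2 := pairing_add_le (Lfun2_lin (- c) (r - c2) Lf1 Lf2)
    (Lfun2_lin (- c) (r - c2) Lg1 Lg2) LW2
    (fun p => sqr_kernel_wave schi p k2ab).
  have La q : ((fun p => q * chi p) : plane R -> R) \in Lfun mu 2%:E.
    apply: (smooth_L2 oOm cB (smooth_scale q schi)) => p Bp.
    by rewrite chi0// mulr0.
  have G1 := pairing_le_add (La a) Lf1 Lg1 (fun p => sqr_partial1_wave a b schi p).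
  have G2 := pairing_le_add (La b) Lf2 Lg2 (fun p => sqr_partial2_wave a b schi p).
  rewrite (pairingZ a Lchi) in G1; rewrite (pairingZ b Lchi) in G2.
  have Du := dirichlet_smooth SOm LE cB BS sf f0 ru.
  have Dv := dirichlet_smooth SOm LE cB BS sg g0 rv.
  have HDuv := HD u v.
  have comb (du dv f1 f2 g1 g2 eu ev vu1 vu2 vv1 vv2 w1 w2 : R) :
      du + dv <= D * (eu + ev) -> du = f1 + f2 -> dv = g1 + g2 ->
      a ^+ 2 * P <= f1 + g1 -> b ^+ 2 * P <= f2 + g2 ->
      eu <= vu1 + vu2 -> ev <= vv1 + vv2 -> vu1 + vv1 <= w1 -> vu2 + vv2 <= w2 ->
      n%:R ^+ 2 * (p1 ^+ 2 + p2 ^+ 2) * P <= D * (w1 + w2).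
    move=> h eu1 ev1 h1 h2 h3 h4 h5 h6; rewrite eu1 ev1 in h.
    have -> : n%:R ^+ 2 * (p1 ^+ 2 + p2 ^+ 2) * P = a ^+ 2 * P + b ^+ 2 * P.
      by rewrite /a /b; ring.
    apply: le_trans (lerD h1 h2) _; rewrite addrACA; apply: le_trans h _.
    rewrite ler_wpM2l//; apply: le_trans (lerD h3 h4) _.
    by rewrite addrACA lerD.
  exact: comb HDuv Du Dv G1 G2 Ru Rv U1 U2.
have K0 : 0 <= D * K by rewrite mulr_ge0// addr_ge0// pairing_ge0.
have q0 : 0 < (p1 ^+ 2 + p2 ^+ 2) * P by rewrite mulr_gt0.
(* By the Archimedean property n times the positive factor exceeds D K, and n <= n^2 contradicts the
   estimate. *)
pose n := Num.bound (D * K / ((p1 ^+ 2 + p2 ^+ 2) * P)).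
have : D * K / ((p1 ^+ 2 + p2 ^+ 2) * P) < n%:R.
  by apply: archi_boundP; rewrite divr_ge0// ltW.
rewrite ltr_pdivrMr// => hn; have := key n; rewrite leNgt => /negP; apply.
apply: lt_le_trans hn _; rewrite -mulrA; apply: ler_wpM2r; first exact: ltW.
rewrite -natrX ler_nat.
by case: (n) => // m; rewrite leq_pmulr.
Qed.

End interior_spectrum.

(** * From the extrema of the coefficients to their values on [S] *)

Theorem lemma1 (R : realType) (Om : set (R * R)) (oOm : open Om)
    (bOm : bounded_set Om) (LOm : lipschitz_domain Om)
    (k1 k2 : R * R -> R)
    (bk1 : [bounded k1 p | p in Om]) (bk2 : [bounded k2 p | p in Om])
    (ik1 : lebesgue_integrable oOm k1) (ik2 : lebesgue_integrable oOm k2)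
    (S : set (R * R)) (oS : open S) (S0 : S !=set0) (SOm : S `<=` Om)
    (ck1 : exists c : R, forall p, S p -> k1 p = c)
    (ck2 : exists c : R, forall p, S p -> k2 p = c)
    (L A : H10space oOm -> Hm1space oOm)
    (LE : forall phi psi, L phi psi =
       \int[lebesgue_on oOm]_p dot (gradient phi p) (gradient psi p))
    (AE : forall phi psi, A phi psi =
       \int[lebesgue_on oOm]_p
         dot (diagonal_tensor k1 k2 p *m gradient phi p) (gradient psi p)) :
  (sup (k1 @` Om) < inf (k2 @` Om) ->
     [set (r%:C)%C | r in `[sup (k1 @` Om), inf (k2 @` Om)]] `<=`
       spectrum (@H10norm R Om oOm) ('pinv_(fun=> 0) setT L \o A)) /\
  (sup (k2 @` Om) < inf (k1 @` Om) ->
     [set (r%:C)%C | r in `[sup (k2 @` Om), inf (k1 @` Om)]] `<=`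
       spectrum (@H10norm R Om oOm) ('pinv_(fun=> 0) setT L \o A)).
Proof.
case: ck1 => c1 ck1; case: ck2 => c2 ck2; have [z Sz] := S0.
have bounds (k : R * R -> R) c : [bounded k p | p in Om] ->
    (forall p, S p -> k p = c) -> inf (k @` Om) <= c <= sup (k @` Om).
  move=> [M [_ HM]] kc; have cI : (k @` Om) c by exists z; [exact: SOm|exact: kc].
  (* Boundedness provides a bound for each constant strictly above [M], hence M + 1. *)
  have kM p : Om p -> `|k p| <= M + 1 by move=> Op; apply: (HM (M + 1)); rewrite ?ltrDl.
  apply/andP; split.
    apply: ge_inf => //; exists (- (M + 1)) => _ [p Op <-].
    by have := kM p Op; rewrite ler_norml => /andP[].
  apply: ub_le_sup => //; exists (M + 1) => _ [p Op <-].
  exact: le_trans (ler_norm _) (kM p Op).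
have /andP[i1 s1] := bounds _ _ bk1 ck1; have /andP[i2 s2] := bounds _ _ bk2 ck2.
(* In the first case c1 <= sup k1 <= r <= inf k2 <= c2, and the strict gap makes c1 and c2 differ,
   so the two factors r - c1 and r - c2 have opposite signs or vanish; the second case exchanges the
   roles. *)
split=> gap _ [r + <-]; rewrite /= in_itv /= => /andP[r1 r2];
  apply: (hyperbolic_in_spectrum SOm ck1 ck2 LE AE oS S0).
- by rewrite lt_eqF//; apply: le_lt_trans s1 (lt_le_trans gap i2).
- by rewrite mulr_ge0_le0// ?subr_ge0 ?subr_le0; [exact: le_trans s1 r1|exact: le_trans r2 i2].
- by rewrite gt_eqF//; apply: le_lt_trans s2 (lt_le_trans gap i1).
- by rewrite mulr_le0_ge0// ?subr_ge0 ?subr_le0; [exact: le_trans r2 i1|exact: le_trans s2 r1].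
Qed.
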